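(* Let $p_1,p_2\in[1,\infty)$ be distinct. Let $A$ be any of $L_d$ ($d\in\{2,3,\dots\}$), $C_d$ ($d\in\{2,3,\dots\}$), or $L_\infty$, and let $\rho\colon A\to L(l^{p_1}(\mathbb{Z}_{>0}))$ be a spatial representation. Then there is no nonzero continuous homomorphism from $\overline{\rho(A)}$ to $L(l^{p_2}(\mathbb{Z}_{>0}))$.
   Context: $L_d$ is the universal complex unital algebra generated by $s_1,\dots,s_d,t_1,\dots,t_d$ with $t_js_j=1$, $t_js_k=0$ ($j\ne k$), $\sum_js_jt_j=1$. $C_d$ is the universal complex unital algebra on the same generators with only the relations $t_js_j=1$, $t_js_k=0$ ($j\ne k$). $L_\infty$ is the universal complex unital algebra on $s_1,s_2,\dots,t_1,t_2,\dots$ with $t_js_j=1$, $t_js_k=0$ ($j\ne k$). A representation is a unital algebra homomorphism into $L(E)$. A representation $\rho$ on $L^p(X,\mu)$ (here $l^{p}$ with counting measure) is spatial if each $\rho(s_j)$, $\rho(t_j)$ is a spatial partial isometry with $\rho(t_j)$ the reverse of $\rho(s_j)$. Spatial partial isometries: Let $(X,\mathcal{B},\mu)$, $(Y,\mathcal{C},\nu)$ be $\sigma$-finite measure spaces, $\mathcal{N}(\mu)$ the $\mu$-null sets, $\mathcal{B}/\mathcal{N}(\mu)$ the Boolean $\sigma$-algebra of measurable sets modulo null sets. A measurable set transformation is a map $S\colon\mathcal{B}/\mathcal{N}(\mu)\to\mathcal{C}/\mathcal{N}(\nu)$ which is a Boolean algebra homomorphism preserving countable unions; it induces a unique linear map $S_*$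 on measurable functions mod a.e. equality with $S_*(\chi_E)=\chi_{S(E)}$ preserving a.e. limits of sequences; for bijective $S$, $S_*(\mu)(F)=\mu(E)$ when $S([E])=[F]$. A spatial system is $(E,F,S,g)$ with $E\in\mathcal{B}$, $F\in\mathcal{C}$, $S$ a bijective measurable set transformation from $(E,\mu|_E)$ to $(F,\nu|_F)$, $g$ measurable on $F$ with $|g|=1$ a.e.; the associated spatial partial isometry is $(s\xi)(y)=g(y)[\tfrac{dS_*(\mu|_E)}{d\nu|_F}(y)]^{1/p}S_*(\xi|_E)(y)$ on $F$ and $0$ off $F$; its reverse has spatial system $(F,E,S^{-1},(S^{-1})_*(g)^{-1})$. *)

(* Defs.v *)
From Stdlib Require Import Reals ClassicalEpsilon.
Open Scope R_scope.

Definition C : Type := (R * R)%type.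
Definition C0 : C := (0, 0).
Definition C1 : C := (1, 0).
Definition RtoC (r : R) : C := (r, 0).
Definition Cadd (a b : C) : C := (fst a + fst b, snd a + snd b).
Definition Copp (a : C) : C := (- fst a, - snd a).
Definition Csub (a b : C) : C := Cadd a (Copp b).
Definition Cmul (a b : C) : C :=
  (fst a * fst b - snd a * snd b, fst a * snd b + snd a * fst b).
Definition Cmod (a : C) : R := sqrt (fst a * fst a + snd a * snd a).
Definition Cinv (a : C) : C :=
  let n := fst a * fst a + snd a * snd a in (fst a / n, - snd a / n).

Definition Ccv (u : nat -> C) (l : C) : Prop :=
  forall eps, 0 < eps -> exists N, forall n, (N <= n)%nat -> Cmod (Csub (u n) l) < eps.

Definition rpow (x p : R) : R := if Rle_dec x 0 then 0 else Rpower x p.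

(* ---------- sequences on the index set (counting measure) ----------
   The index set Z_{>0} is identified with nat via n |-> n+1. *)
Definition Seq := nat -> C.
Definition Szero : Seq := fun _ => C0.
Definition Sadd (x y : Seq) : Seq := fun n => Cadd (x n) (y n).
Definition Sscale (c : C) (x : Seq) : Seq := fun n => Cmul c (x n).
Definition Ssub (x y : Seq) : Seq := fun n => Csub (x n) (y n).
Definition Seq_eq (x y : Seq) : Prop := forall n, x n = y n.

Definition lp_norm_le (p : R) (x : Seq) (c : R) : Prop :=
  0 <= c /\ forall N, sum_f_R0 (fun n => rpow (Cmod (x n)) p) N <= rpow c p.
Definition in_lp (p : R) (x : Seq) : Prop := exists c, lp_norm_le p x c.

Definition Op := Seq -> Seq.
Definition Oid : Op := fun x => x.
Definition Ozero : Op := fun _ => Szero.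
Definition Oadd (S T : Op) : Op := fun x => Sadd (S x) (T x).
Definition Osub (S T : Op) : Op := fun x => Ssub (S x) (T x).
Definition Oscale (c : C) (T : Op) : Op := fun x => Sscale c (T x).
Definition Omul (S T : Op) : Op := fun x => S (T x).

Definition op_eq (p : R) (S T : Op) : Prop :=
  forall x, in_lp p x -> Seq_eq (S x) (T x).

Definition is_bdd (p : R) (T : Op) : Prop :=
  (forall x y, in_lp p x -> in_lp p y -> Seq_eq (T (Sadd x y)) (Sadd (T x) (T y))) /\
  (forall c x, in_lp p x -> Seq_eq (T (Sscale c x)) (Sscale c (T x))) /\
  (exists M, 0 <= M /\ forall x, in_lp p x ->
     forall b, lp_norm_le p x b -> lp_norm_le p (T x) (M * b)).

Definition opnorm_lt (p : R) (T : Op) (r : R) : Prop :=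
  exists c, 0 <= c < r /\ forall x, in_lp p x ->
    forall b, lp_norm_le p x b -> lp_norm_le p (T x) (c * b).

Definition set := nat -> Prop.
Definition sub (A B : set) : Prop := forall n, A n -> B n.
Definition seteq (A B : set) : Prop := forall n, A n <-> B n.

(* bijective measurable set transformation from (E, mu|_E) to (F, nu|_F);
   for counting measure the only null set is the empty set *)
Definition is_bij_mst (E F : set) (S : set -> set) : Prop :=
  (forall A, sub A E -> sub (S A) F) /\
  (forall A B, sub A E -> sub B E -> seteq A B -> seteq (S A) (S B)) /\
  seteq (S E) F /\
  (forall A, sub A E -> seteq (S (fun n => E n /\ ~ A n)) (fun n => F n /\ ~ S A n)) /\
  (forall A B, sub A E -> sub B E ->
     seteq (S (fun n => A n /\ B n)) (fun n => S A n /\ S B n)) /\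
  (forall A B, sub A E -> sub B E ->
     seteq (S (fun n => A n \/ B n)) (fun n => S A n \/ S B n)) /\
  (forall An : nat -> set, (forall k, sub (An k) E) ->
     seteq (S (fun n => exists k, An k n)) (fun n => exists k, S (An k) n)) /\
  (forall A B, sub A E -> sub B E -> seteq (S A) (S B) -> seteq A B) /\
  (forall B, sub B F -> exists A, sub A E /\ seteq (S A) B).

Definition is_pushforward (E F : set) (S : set -> set) (Sstar : Seq -> Seq) : Prop :=
  (forall xi eta, (forall n, E n -> xi n = eta n) ->
     forall y, F y -> Sstar xi y = Sstar eta y) /\
  (forall xi eta y, F y -> Sstar (Sadd xi eta) y = Cadd (Sstar xi y) (Sstar eta y)) /\
  (forall c xi y, F y -> Sstar (Sscale c xi) y = Cmul c (Sstar xi y)) /\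
  (forall A xi, sub A E ->
     (forall n, E n -> (A n -> xi n = C1) /\ (~ A n -> xi n = C0)) ->
     forall y, F y -> (S A y -> Sstar xi y = C1) /\ (~ S A y -> Sstar xi y = C0)) /\
  (forall (xis : nat -> Seq) (xi : Seq), (forall n, E n -> Ccv (fun k => xis k n) (xi n)) ->
     forall y, F y -> Ccv (fun k => Sstar (xis k) y) (Sstar xi y)).

Definition card_is (A : set) (n : nat) : Prop :=
  exists l : list nat, List.NoDup l /\ (forall m, A m <-> List.In m l) /\ List.length l = n.

Definition indic (B : set) (h : nat -> R) : nat -> R :=
  fun y => if excluded_middle_informative (B y) then h y else 0.

(* h = d S_*(mu|_E) / d nu|_F : for every B subset of F,
   int_B h d(nu) = S_*(mu|_E)(B) = mu(A) where S(A) = B (values in [0, oo]) *)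
Definition is_RN (E F : set) (S : set -> set) (h : nat -> R) : Prop :=
  (forall y, F y -> 0 <= h y) /\
  (forall A B, sub A E -> sub B F -> seteq (S A) B ->
     (forall n, card_is A n <-> infinite_sum (indic B h) (INR n)) /\
     ((forall n, ~ card_is A n) <->
        (forall M, exists N, M < sum_f_R0 (indic B h) N))).

Definition spi_of (p : R) (E F : set) (S : set -> set) (Sstar : Seq -> Seq)
    (g : Seq) (h : nat -> R) (s : Op) : Prop :=
  is_bij_mst E F S /\ is_pushforward E F S Sstar /\ is_RN E F S h /\
  (forall y, F y -> Cmod (g y) = 1) /\
  (forall xi, in_lp p xi -> forall y,
     (F y -> s xi y = Cmul (g y) (Cmul (RtoC (rpow (h y) (1 / p))) (Sstar xi y))) /\
     (~ F y -> s xi y = C0)).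

(* t is a spatial partial isometry which is the reverse of the spatial
   partial isometry s: its system is (F, E, S^-1, (S^-1)_*(g)^-1) *)
Definition is_spatial_reverse (p : R) (s t : Op) : Prop :=
  exists E F S Sstar g h, spi_of p E F S Sstar g h s /\
  exists S' Sstar' h',
    (forall A, sub A E -> seteq (S' (S A)) A) /\
    (forall B, sub B F -> seteq (S (S' B)) B) /\
    spi_of p F E S' Sstar' (fun x => Cinv (Sstar' g x)) h' t.

Inductive cuntz_kind := KL (d : nat) | KC (d : nat) | KLinf.

Definition kind_ok (k : cuntz_kind) : Prop :=
  match k with KL d | KC d => (2 <= d)%nat | KLinf => True end.

Definition in_range (k : cuntz_kind) (j : nat) : Prop :=
  match k with KL d | KC d => (j < d)%nat | KLinf => True end.

(* noncommutative polynomial expressions in the generators s_j, t_j *)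
Inductive term :=
  | tconst (c : C) | tS (j : nat) | tT (j : nat)
  | tadd (a b : term) | tmul (a b : term).

Fixpoint term_ok (k : cuntz_kind) (a : term) : Prop :=
  match a with
  | tconst _ => True
  | tS j | tT j => in_range k j
  | tadd a b | tmul a b => term_ok k a /\ term_ok k b
  end.

(* rho applied to the element of A represented by the term *)
Fixpoint eval (Ss Tt : nat -> Op) (a : term) : Op :=
  match a with
  | tconst c => Oscale c Oid
  | tS j => Ss j
  | tT j => Tt j
  | tadd a b => Oadd (eval Ss Tt a) (eval Ss Tt b)
  | tmul a b => Omul (eval Ss Tt a) (eval Ss Tt b)
  end.

Fixpoint Osum (d : nat) (f : nat -> Op) : Op :=
  match d with O => Ozero | S d' => Oadd (Osum d' f) (f d') end.

(* a unital representation rho : A -> L(l^p), given (by universality of A)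
   by the images Ss j = rho(s_j), Tt j = rho(t_j) satisfying the relations *)
Definition is_rep (p : R) (k : cuntz_kind) (Ss Tt : nat -> Op) : Prop :=
  (forall j, in_range k j -> is_bdd p (Ss j) /\ is_bdd p (Tt j)) /\
  (forall j, in_range k j -> op_eq p (Omul (Tt j) (Ss j)) Oid) /\
  (forall j l, in_range k j -> in_range k l -> j <> l ->
     op_eq p (Omul (Tt j) (Ss l)) Ozero) /\
  (match k with
   | KL d => op_eq p (Osum d (fun j => Omul (Ss j) (Tt j))) Oid
   | _ => True end).

Definition is_spatial_rep (p : R) (k : cuntz_kind) (Ss Tt : nat -> Op) : Prop :=
  is_rep p k Ss Tt /\
  (forall j, in_range k j -> is_spatial_reverse p (Ss j) (Tt j)).

Definition closure_img (p : R) (k : cuntz_kind) (Ss Tt : nat -> Op) (T : Op) : Prop :=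
  is_bdd p T /\
  forall eps, 0 < eps -> exists a, term_ok k a /\ opnorm_lt p (Osub T (eval Ss Tt a)) eps.

Definition is_cont_hom (p1 p2 : R) (B : Op -> Prop) (phi : Op -> Op) : Prop :=
  (forall T T', B T -> B T' -> op_eq p1 T T' -> op_eq p2 (phi T) (phi T')) /\
  (forall T, B T -> is_bdd p2 (phi T)) /\
  (forall T T', B T -> B T' -> op_eq p2 (phi (Oadd T T')) (Oadd (phi T) (phi T'))) /\
  (forall T T', B T -> B T' -> op_eq p2 (phi (Omul T T')) (Omul (phi T) (phi T'))) /\
  (forall c T, B T -> op_eq p2 (phi (Oscale c T)) (Oscale c (phi T))) /\
  (forall T, B T -> forall eps, 0 < eps -> exists delta, 0 < delta /\
     forall T', B T' -> opnorm_lt p1 (Osub T' T) delta ->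
       opnorm_lt p2 (Osub (phi T') (phi T)) eps).

(* Main.v *)
Require Import Defs.
From Stdlib Require Import Reals Arith Lra Lia List FinFun Classical ClassicalEpsilon
  FunctionalExtensionality.
(* Reals also exports [C] (binomials) and [C1] (a class of functions). *)
Import Defs.
Open Scope R_scope.

(** Write [v n = s_0^n s_1] and [w n = t_1 t_0^n], so that [w n v m = delta n m].
    A spatial representation moves points injectively with disjoint ranges, hence on
    [l^p1] a signed sum of [n] distinct [v]'s has norm at most [n^(1/p1)] and the same
    signed sum of [w]'s has norm at most [n^(1-1/p1)].  If [phi] is a nonzero bounded
    homomorphism and [xi <> 0] satisfies [phi 1 xi = xi], the vectors [phi (v n) xi]
    in [l^p2] therefore have signed sums of norm comparable to [n^(1/p1)].  But
    differences of these vectors can be chosen to be almost disjoint humps, and sums of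
    [n] such differences have norm comparable to [n^(1/p2)], so [p1 = p2]. *)

(** * Powers of absolute values *)

(** The lower bound comes from [w n v m = delta n m]: a signed sum of [n] distinct [w]'s times the
    sum of the corresponding [v]'s with the same signs is [n] times the identity. The [n^(1-1/p1)]
    bound on the first factor, pushed through [phi], therefore forces at least a multiple of
    [n^(1/p1)] on the second. Continuity supplies a constant that is uniform in [n]. Differences are
    used because the vectors [phi (v n) xi] have no reason to tend to 0 in each coordinate.
    Boundedness and the pigeonhole principle make some difference small on any given finite set of
    coordinates, and this works for exponent 1 too, without weak compactness. It is also why
    arbitrary signs are carried through all estimates. Norms are handled through their [p]-th
    powers, which add over disjoint supports; the growth exponent then reads [r = p2/p1], to be
    compared with 1. The words involve only the indices 0 and 1, which all three families of
    algebras provide. *)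

Lemma C_ring : ring_theory C0 C1 Cadd Cmul Csub Copp eq.
Proof.
  constructor; intros; unfold Csub, Cadd, Cmul, Copp, C0, C1;
    repeat match goal with x : C |- _ => destruct x end;
    simpl; f_equal; ring.
Qed.
Add Ring C_ring : C_ring.

Lemma Cmod_ge_0 (a : C) : 0 <= Cmod a.
Proof. apply sqrt_pos. Qed.

Lemma Cmod_C0 : Cmod C0 = 0.
Proof.
  unfold Cmod, C0; simpl. replace (0 * 0 + 0 * 0) with 0 by ring. apply sqrt_0.
Qed.

Lemma Cmod_RtoC (r : R) : Cmod (RtoC r) = Rabs r.
Proof.
  unfold Cmod, RtoC; simpl. rewrite <- sqrt_Rsqr_abs. unfold Rsqr. f_equal; ring.
Qed.

Lemma Cmod_mul (a b : C) : Cmod (Cmul a b) = Cmod a * Cmod b.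
Proof.
  destruct a as [a a'], b as [b b']; unfold Cmod, Cmul; simpl.
  rewrite <- sqrt_mult by nra. f_equal; ring.
Qed.

Lemma Cmod_add_le (a b : C) : Cmod (Cadd a b) <= Cmod a + Cmod b.
Proof.
  destruct a as [a a'], b as [b b']; unfold Cmod, Cadd; simpl.
  set (u := sqrt (a * a + a' * a')). set (v := sqrt (b * b + b' * b')).
  assert (Hu : u * u = a * a + a' * a') by (apply sqrt_sqrt; nra).
  assert (Hv : v * v = b * b + b' * b') by (apply sqrt_sqrt; nra).
  assert (Hu0 : 0 <= u) by apply sqrt_pos.
  assert (Hv0 : 0 <= v) by apply sqrt_pos.
  rewrite <- (sqrt_square (u + v)) by lra.
  apply sqrt_le_1_alt.
  assert (a * b + a' * b' <= u * v); [|nra].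
  apply Rsqr_incr_0_var; [unfold Rsqr|nra].
  replace (u * v * (u * v)) with (u * u * (v * v)) by ring.
  rewrite Hu, Hv. pose proof (Rle_0_sqr (a * b' - a' * b)) as Q; unfold Rsqr in Q; nra.
Qed.

Lemma Cmod_eq_0 (a : C) : Cmod a = 0 -> a = C0.
Proof.
  destruct a as [a a']; unfold Cmod, C0; simpl; intro H.
  apply sqrt_eq_0 in H; [|nra]. f_equal; nra.
Qed.

Lemma rpow_0 (p : R) : rpow 0 p = 0.
Proof. unfold rpow; destruct (Rle_dec 0 0); lra. Qed.

Lemma rpow_Rpower (x p : R) : 0 < x -> rpow x p = Rpower x p.
Proof. intro; unfold rpow; destruct (Rle_dec x 0); lra. Qed.

Lemma rpow_pos (x p : R) : 0 < x -> 0 < rpow x p.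
Proof. intro; rewrite rpow_Rpower by auto; apply exp_pos. Qed.

Lemma rpow_ge_0 (x p : R) : 0 <= rpow x p.
Proof. unfold rpow; destruct (Rle_dec x 0); [lra | left; apply exp_pos]. Qed.

Lemma rpow_1_l (p : R) : rpow 1 p = 1.
Proof. rewrite rpow_Rpower by lra; unfold Rpower; rewrite ln_1, Rmult_0_r; apply exp_0. Qed.

Lemma rpow_1_r (x : R) : 0 <= x -> rpow x 1 = x.
Proof.
  intros [H | <-]; [rewrite rpow_Rpower by auto; now apply Rpower_1 | apply rpow_0].
Qed.

Lemma rpow_mult (a b p : R) : 0 <= a -> 0 <= b -> rpow (a * b) p = rpow a p * rpow b p.
Proof.
  intros [Ha | <-]; [intros [Hb | <-]|].
  - rewrite !rpow_Rpower by auto using Rmult_lt_0_compat. symmetry; now apply Rpower_mult_distr.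
  - rewrite Rmult_0_r, rpow_0; ring.
  - intros _; rewrite Rmult_0_l, rpow_0; ring.
Qed.

Lemma rpow_le (a b p : R) : 0 <= p -> 0 <= a <= b -> rpow a p <= rpow b p.
Proof.
  intros Hp [[Ha | <-] Hb].
  - rewrite !rpow_Rpower by lra. apply Rle_Rpower_l; lra.
  - rewrite rpow_0; apply rpow_ge_0.
Qed.

Lemma rpow_rpow (x s t : R) : 0 <= x -> rpow (rpow x s) t = rpow x (s * t).
Proof.
  intros [H | <-]; [|now rewrite !rpow_0].
  rewrite rpow_Rpower by now apply rpow_pos.
  rewrite !rpow_Rpower by auto. apply Rpower_mult.
Qed.

Lemma rpow_root (x p : R) : 0 < p -> 0 <= x -> rpow (rpow x (1 / p)) p = x.
Proof.
  intros Hp Hx. rewrite rpow_rpow by auto.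
  replace (1 / p * p) with 1 by (field; lra). now apply rpow_1_r.
Qed.

Lemma rpow_plus (x s t : R) : 0 <= x -> rpow x (s + t) = rpow x s * rpow x t.
Proof.
  intros [H | <-]; [|rewrite !rpow_0; ring].
  rewrite !rpow_Rpower by auto. apply Rpower_plus.
Qed.

Lemma rpow_le_inv (a b p : R) : 0 < p -> 0 <= a -> 0 <= b -> rpow a p <= rpow b p -> a <= b.
Proof.
  intros Hp Ha Hb H. apply Rnot_lt_le; intro L.
  destruct Hb as [Hb | <-].
  - rewrite !rpow_Rpower in H by lra.
    assert (Rpower b p < Rpower a p) by (apply Rlt_Rpower_l; lra). lra.
  - rewrite rpow_0 in H. pose proof (rpow_pos a p L). lra.
Qed.

Lemma rpow_unbounded (s c : R) : 0 < s -> exists N, (1 <= N)%nat /\ c < rpow (INR N) s.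
Proof.
  intro Hs. set (c' := Rmax c 1).
  assert (Hc : c <= c') by apply Rmax_l. assert (Hc1 : 1 <= c') by apply Rmax_r.
  destruct (INR_unbounded (rpow c' (1 / s))) as [N HN].
  pose proof (rpow_pos c' (1 / s) ltac:(lra)).
  exists N; split.
  - destruct N; [simpl in HN; lra | lia].
  - apply Rle_lt_trans with c'; auto. apply Rnot_le_lt; intro L.
    rewrite <- (rpow_root c' s) in L by lra.
    apply rpow_le_inv in L; lra.
Qed.

(** From [a + b <= 2 * Rmax a b]. This crude constant replaces Minkowski's inequality, since only
    growth rates are compared in the end. *)
Lemma rpow_add_le (a b p : R) : 0 <= p -> 0 <= a -> 0 <= b ->
  rpow (a + b) p <= rpow 2 p * (rpow a p + rpow b p).
Proof.
  intros Hp Ha Hb.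
  pose proof (rpow_ge_0 a p); pose proof (rpow_ge_0 b p); pose proof (rpow_ge_0 2 p).
  apply Rle_trans with (rpow (2 * Rmax a b) p).
  - apply rpow_le; auto. pose proof (Rmax_l a b); pose proof (Rmax_r a b). lra.
  - rewrite rpow_mult; [|lra|apply Rle_trans with a; auto; apply Rmax_l].
    apply Rmult_le_compat_l; auto.
    unfold Rmax; destruct (Rle_dec a b); lra.
Qed.

(** The tangent line of [u^p] at [u = 1]. With [u = exp L] it follows from [1 + x <= exp x] at
    [x = (p - 1) * L] and at [x = - L]. *)
Lemma rpow_bernoulli (u p : R) : 1 <= p -> 0 <= u -> p * u <= rpow u p + (p - 1).
Proof.
  intros Hp [Hu | <-]; [|rewrite rpow_0; lra].
  rewrite rpow_Rpower by auto; unfold Rpower.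
  set (L := ln u). assert (E : u = exp L) by (symmetry; now apply exp_ln).
  rewrite E at 1. clearbody L.
  replace (p * L) with (L + (p - 1) * L) by ring. rewrite exp_plus.
  assert (H1 : 1 + (p - 1) * L <= exp ((p - 1) * L)) by apply exp_ineq1_le.
  assert (H2 : 1 + - L <= exp (- L)) by apply exp_ineq1_le.
  assert (H3 : exp L * exp (- L) = 1) by (rewrite <- exp_plus, Rplus_opp_r; apply exp_0).
  pose proof (exp_pos L).
  assert (exp L * (1 + (p - 1) * L) <= exp L * exp ((p - 1) * L)) by (apply Rmult_le_compat_l; lra).
  assert (exp L * (1 + - L) <= 1) by (rewrite <- H3; apply Rmult_le_compat_l; lra).
  nra.
Qed.

(** * Finite sums over lists and Jensen's inequality *)

Definition lsum {I : Type} (f : I -> R) (l : list I) : R :=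
  fold_right (fun i acc => f i + acc) 0 l.

Lemma lsum_le {I : Type} (f g : I -> R) (l : list I) :
  (forall i, In i l -> f i <= g i) -> lsum f l <= lsum g l.
Proof.
  induction l as [|i l IH]; intro H; simpl; [lra|].
  apply Rplus_le_compat; [apply H; now left | apply IH; intros; apply H; now right].
Qed.

Lemma lsum_nonneg {I : Type} (f : I -> R) (l : list I) :
  (forall i, 0 <= f i) -> 0 <= lsum f l.
Proof. intro H; induction l; simpl; [lra | specialize (H a); lra]. Qed.

Lemma lsum_app {I : Type} (f : I -> R) (l l' : list I) :
  lsum f (l ++ l') = lsum f l + lsum f l'.
Proof. induction l; simpl; lra. Qed.

Lemma lsum_map {I J : Type} (f : J -> R) (h : I -> J) (l : list I) :
  lsum f (map h l) = lsum (fun i => f (h i)) l.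
Proof. induction l; simpl; congruence. Qed.

(* Jensen, by summing the tangent line inequality at the mean [m]. *)
Lemma rpow_lsum_le {I : Type} (f : I -> R) (l : list I) (p : R) :
  1 <= p -> (forall i, 0 <= f i) ->
  rpow (lsum f l) p <= rpow (INR (length l)) (p - 1) * lsum (fun i => rpow (f i) p) l.
Proof.
  intros Hp Hf.
  assert (Hs := lsum_nonneg f l Hf).
  assert (Hs' := lsum_nonneg (fun i => rpow (f i) p) l (fun i => rpow_ge_0 _ _)).
  destruct Hs as [Hs | Hs].
  2: { rewrite <- Hs, rpow_0. apply Rmult_le_pos; auto using rpow_ge_0. }
  set (n := INR (length l)).
  assert (Hn : 0 < n).
  { unfold n. destruct l; [simpl in Hs; lra|]. apply lt_0_INR; simpl; lia. }
  set (m := lsum f l / n).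
  assert (Hm : 0 < m) by (apply Rdiv_lt_0_compat; auto).
  assert (T : forall k, lsum (fun i => p * (f i / m) - (p - 1)) k
                = p * (lsum f k / m) - INR (length k) * (p - 1)).
  { induction k as [|i k IH]; [simpl; field; lra|].
    rewrite length_cons, S_INR. simpl. simpl in IH. rewrite IH. field; lra. }
  assert (H : lsum (fun i => p * (f i / m) - (p - 1)) l <= lsum (fun i => rpow (f i / m) p) l).
  { apply lsum_le; intros i _.
    assert (0 <= f i / m).
    { apply Rmult_le_pos; [apply Hf | left; now apply Rinv_0_lt_compat]. }
    pose proof (rpow_bernoulli (f i / m) p Hp H). lra. }
  rewrite T in H. fold n in H.
  replace (lsum f l / m) with n in H by (unfold m; field; lra).
  assert (T2 : forall k, rpow m p * lsum (fun i => rpow (f i / m) p) k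
                 = lsum (fun i => rpow (f i) p) k).
  { induction k as [|i k IH]; [simpl; ring|].
    simpl. rewrite <- IH, Rmult_plus_distr_l. f_equal.
    rewrite <- rpow_mult; [|lra|].
    - f_equal; field; lra.
    - apply Rmult_le_pos; [apply Hf | left; now apply Rinv_0_lt_compat]. }
  rewrite <- T2.
  replace (lsum f l) with (n * m) by (unfold m; field; lra).
  rewrite rpow_mult by lra.
  replace (rpow n p) with (rpow n (p - 1) * n).
  2: { rewrite <- (rpow_1_r n) at 2 by lra. rewrite <- rpow_plus by lra. f_equal; ring. }
  pose proof (rpow_ge_0 n (p - 1)). pose proof (rpow_ge_0 m p).
  rewrite Rmult_assoc. apply Rmult_le_compat_l; auto.
  rewrite (Rmult_comm n). apply Rmult_le_compat_l; auto. lra.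
Qed.

(** * p-th powers of norms *)

Lemma lsum_plus {I : Type} (f g : I -> R) (l : list I) :
  lsum (fun i => f i + g i) l = lsum f l + lsum g l.
Proof. induction l; simpl; lra. Qed.

Lemma lsum_scal {I : Type} (c : R) (f : I -> R) (l : list I) :
  lsum (fun i => c * f i) l = c * lsum f l.
Proof. induction l as [|i l IH]; simpl; [ring | rewrite IH; ring]. Qed.

Lemma lsum_const {I : Type} (c : R) (l : list I) :
  lsum (fun _ => c) l = INR (length l) * c.
Proof.
  induction l as [|i l IH]; [simpl; ring|].
  rewrite length_cons, S_INR. simpl. simpl in IH. rewrite IH; ring.
Qed.

Lemma lsum_ext {I : Type} (f g : I -> R) (l : list I) :
  (forall i, In i l -> f i = g i) -> lsum f l = lsum g l.
Proof. intro H; apply Rle_antisym; apply lsum_le; intros i Hi; rewrite H; auto; lra. Qed.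

Lemma lsum_swap {I J : Type} (f : I -> J -> R) (l : list I) (k : list J) :
  lsum (fun i => lsum (f i) k) l = lsum (fun j => lsum (fun i => f i j) l) k.
Proof.
  induction l as [|i l IH]; simpl.
  - rewrite lsum_const; ring.
  - rewrite lsum_plus, IH. reflexivity.
Qed.

Lemma lsum_incl {I : Type} (f : I -> R) (l k : list I) :
  (forall i, 0 <= f i) -> NoDup l -> incl l k -> lsum f l <= lsum f k.
Proof.
  intros Hf Hl; revert k; induction Hl as [|i l Hi Hl IH]; intros k Hk; simpl.
  - now apply lsum_nonneg.
  - destruct (in_split i k (Hk i (or_introl eq_refl))) as (k1 & k2 & ->).
    assert (H : lsum f l <= lsum f (k1 ++ k2)).
    { apply IH. intros j Hj. specialize (Hk j (or_intror Hj)).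
      apply in_app_or in Hk. apply in_or_app.
      destruct Hk as [Hk | [-> | Hk]]; tauto. }
    rewrite lsum_app in *; simpl. lra.
Qed.

Lemma sum_f_R0_lsum (f : nat -> R) (N : nat) : sum_f_R0 f N = lsum f (seq 0 (S N)).
Proof.
  induction N as [|N IH]; [simpl; ring|].
  rewrite seq_S, lsum_app, <- IH. simpl; ring.
Qed.

Definition modp (p : R) (z : C) : R := rpow (Cmod z) p.

Lemma modp_ge_0 (p : R) (z : C) : 0 <= modp p z.
Proof. apply rpow_ge_0. Qed.

Lemma modp_C0 (p : R) : modp p C0 = 0.
Proof. unfold modp; rewrite Cmod_C0; apply rpow_0. Qed.

Lemma modp_mul (p : R) (z w : C) : modp p (Cmul z w) = modp p z * modp p w.
Proof. unfold modp; rewrite Cmod_mul; apply rpow_mult; apply Cmod_ge_0. Qed.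

Lemma modp_add_le (p : R) (z w : C) : 0 <= p ->
  modp p (Cadd z w) <= rpow 2 p * (modp p z + modp p w).
Proof.
  intro Hp. unfold modp.
  apply Rle_trans with (rpow (Cmod z + Cmod w) p).
  - apply rpow_le; auto. split; [apply Cmod_ge_0 | apply Cmod_add_le].
  - apply rpow_add_le; auto using Cmod_ge_0.
Qed.

(** Here [c] bounds the [p]-th power of the norm. The empty range [N = 0] builds in [0 <= c]. *)
Definition pnorm_le (p : R) (x : Seq) (c : R) : Prop :=
  forall N, lsum (fun n => modp p (x n)) (seq 0 N) <= c.

Lemma pnorm_le_ge_0 (p : R) (x : Seq) (c : R) : pnorm_le p x c -> 0 <= c.
Proof. intro H; exact (H 0%nat). Qed.

Lemma pnorm_le_weaken (p : R) (x : Seq) (c d : R) : c <= d -> pnorm_le p x c -> pnorm_le p x d.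
Proof. intros H Hx N; specialize (Hx N); lra. Qed.

Lemma lp_norm_leE (p : R) (x : Seq) (c : R) :
  lp_norm_le p x c <-> 0 <= c /\ pnorm_le p x (rpow c p).
Proof.
  unfold lp_norm_le, pnorm_le. split; intros [Hc H]; split; auto; intro N.
  - destruct N as [|N]; [apply rpow_ge_0|].
    specialize (H N). rewrite sum_f_R0_lsum in H. exact H.
  - rewrite sum_f_R0_lsum. apply H.
Qed.

Lemma pnorm_le_root (p : R) (x : Seq) (c : R) :
  0 < p -> pnorm_le p x c -> lp_norm_le p x (rpow c (1 / p)).
Proof.
  intros Hp H. apply lp_norm_leE. split; [apply rpow_ge_0|].
  rewrite rpow_root; auto. eapply pnorm_le_ge_0; eauto.
Qed.

Lemma pnorm_le_in_lp (p : R) (x : Seq) (c : R) : 0 < p -> pnorm_le p x c -> in_lp p x.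
Proof. intros Hp H; eexists; apply pnorm_le_root; eauto. Qed.

Lemma in_lp_pnorm_le (p : R) (x : Seq) : in_lp p x -> exists c, pnorm_le p x c.
Proof. intros [c H]; apply lp_norm_leE in H; eexists; apply H. Qed.

(** This is how injections act on norms: the image or preimage of a range of coordinates is a
    duplicate-free list, not an initial segment. *)
Lemma pnorm_le_list (p : R) (x : Seq) (c : R) (l : list nat) :
  pnorm_le p x c -> NoDup l -> lsum (fun n => modp p (x n)) l <= c.
Proof.
  intros H Hl. apply Rle_trans with (2 := H (S (list_max l))).
  apply lsum_incl; auto using modp_ge_0.
  intros i Hi. apply in_seq. split; [lia|]. simpl.
  assert (Hm := proj1 (list_max_le l (list_max l)) (le_n _)).
  rewrite Forall_forall in Hm. specialize (Hm i Hi). lia.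
Qed.

Lemma pnorm_le_coord (p : R) (x : Seq) (c : R) (n : nat) :
  pnorm_le p x c -> modp p (x n) <= c.
Proof.
  intro H. assert (L := pnorm_le_list p x c (n :: nil) H).
  simpl in L. rewrite Rplus_0_r in L. apply L. constructor; [intros [] | constructor].
Qed.

Lemma pnorm_le_add (p : R) (x y : Seq) (a b : R) : 0 <= p ->
  pnorm_le p x a -> pnorm_le p y b -> pnorm_le p (Sadd x y) (rpow 2 p * (a + b)).
Proof.
  intros Hp Hx Hy N.
  apply Rle_trans with (lsum (fun n => rpow 2 p * (modp p (x n) + modp p (y n))) (seq 0 N)).
  - apply lsum_le; intros; now apply modp_add_le.
  - rewrite lsum_scal, lsum_plus. apply Rmult_le_compat_l; [apply rpow_ge_0|].
    specialize (Hx N); specialize (Hy N); lra.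
Qed.

Lemma pnorm_le_scale (p : R) (c : C) (x : Seq) (a : R) :
  pnorm_le p x a -> pnorm_le p (Sscale c x) (modp p c * a).
Proof.
  intros Hx N. unfold Sscale.
  rewrite (lsum_ext _ (fun n => modp p c * modp p (x n))) by (intros; apply modp_mul).
  rewrite lsum_scal. apply Rmult_le_compat_l; [apply modp_ge_0 | apply Hx].
Qed.

Lemma pnorm_le_mono (p : R) (x y : Seq) (c : R) :
  (forall n, modp p (y n) <= modp p (x n)) -> pnorm_le p x c -> pnorm_le p y c.
Proof.
  intros H Hx N. apply Rle_trans with (2 := Hx N). apply lsum_le; auto.
Qed.

Lemma in_lp_add (p : R) (x y : Seq) : 0 < p -> in_lp p x -> in_lp p y -> in_lp p (Sadd x y).
Proof.
  intros Hp Hx Hy.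
  destruct (in_lp_pnorm_le _ _ Hx) as [a Ha], (in_lp_pnorm_le _ _ Hy) as [b Hb].
  eapply pnorm_le_in_lp; auto. apply pnorm_le_add; eauto; lra.
Qed.

Lemma in_lp_scale (p : R) (c : C) (x : Seq) : 0 < p -> in_lp p x -> in_lp p (Sscale c x).
Proof.
  intros Hp Hx. destruct (in_lp_pnorm_le _ _ Hx) as [a Ha].
  eapply pnorm_le_in_lp; auto. apply pnorm_le_scale; eauto.
Qed.

Definition single (a : nat) : Seq := fun n => if Nat.eq_dec n a then C1 else C0.

Lemma modp_C1 (p : R) : modp p C1 = 1.
Proof.
  unfold modp. change C1 with (RtoC 1). rewrite Cmod_RtoC, Rabs_R1. apply rpow_1_l.
Qed.

Lemma in_lp_single (p : R) (a : nat) : 0 < p -> in_lp p (single a).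
Proof.
  intro Hp. apply (pnorm_le_in_lp p _ 1 Hp). intro N.
  enough (H : lsum (fun n => modp p (single a n)) (seq 0 N) = if le_lt_dec N a then 0 else 1).
  { rewrite H. destruct (le_lt_dec N a); lra. }
  induction N as [|N IH].
  - simpl. destruct (le_lt_dec 0 a); [auto|lia].
  - rewrite seq_S, lsum_app, IH. cbn [lsum fold_right Nat.add]. unfold single.
    destruct (Nat.eq_dec N a); rewrite ?modp_C1, ?modp_C0;
    destruct (le_lt_dec N a), (le_lt_dec (S N) a); try lia; ring.
Qed.

Definition sgn (b : bool) : C := if b then C1 else Copp C1.

Lemma Cmod_sgn (b : bool) : Cmod (sgn b) = 1.
Proof.
  destruct b; unfold sgn, Cmod, Copp, C1; simpl; apply sqrt_lem_1; lra.
Qed.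

Lemma modp_sgn (p : R) (b : bool) : modp p (sgn b) = 1.
Proof. unfold modp; rewrite Cmod_sgn; apply rpow_1_l. Qed.

Definition scomb (l : list (bool * nat)) (X : nat -> C) : C :=
  fold_right (fun e acc => Cadd (Cmul (sgn (fst e)) (X (snd e))) acc) C0 l.

(** * Pigeonhole on finitely many coordinates, and small tails *)

Definition infinite (Q : nat -> Prop) : Prop := forall k, exists n, (k <= n)%nat /\ Q n.

(** Either infinitely many values lie in the lowest subinterval of length [d], or from some index on
    all values lie above it and one subinterval fewer remains. *)
Lemma pigeonhole_R (k : nat) (f : nat -> R) (d : R) : 0 < d ->
  forall (Q : nat -> Prop) (lo : R), infinite Q ->
  (forall n, Q n -> lo <= f n <= lo + INR k * d) ->
  exists Q', (forall n, Q' n -> Q n) /\ infinite Q' /\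
    forall a b, Q' a -> Q' b -> Rabs (f a - f b) <= d.
Proof.
  intro Hd. induction k as [|k IH]; intros Q lo HQ Hf.
  - exists Q; split; [auto|split; [auto|]]. intros a b Ha Hb.
    apply Hf in Ha; apply Hf in Hb. simpl in Ha, Hb. apply Rabs_le; lra.
  - destruct (classic (infinite (fun n => Q n /\ f n <= lo + d))) as [I | I].
    + exists (fun n => Q n /\ f n <= lo + d); split; [tauto|split; [auto|]].
      intros a b [Ha Ha'] [Hb Hb']. apply Hf in Ha; apply Hf in Hb. apply Rabs_le; lra.
    + apply not_all_ex_not in I. destruct I as [K HK].
      destruct (IH (fun n => Q n /\ (K <= n)%nat) (lo + d)) as (Q' & H1 & H2 & H3).
      * intro m. destruct (HQ (Nat.max m K)) as (n & Hn & Hq). exists n; repeat split; auto; lia.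
      * intros n [Hq Hn]. specialize (Hf n Hq). rewrite S_INR in Hf. split; [|lra].
        apply Rnot_lt_le; intro L. apply HK. exists n; repeat split; auto; lra.
      * exists Q'; split; [|auto]. intros n Hn; now apply H1.
Qed.

Lemma pigeonhole_bounded (f : nat -> R) (D d : R) (Q : nat -> Prop) : 0 < d -> infinite Q ->
  (forall n, Rabs (f n) <= D) ->
  exists Q', (forall n, Q' n -> Q n) /\ infinite Q' /\
    forall a b, Q' a -> Q' b -> Rabs (f a - f b) <= d.
Proof.
  intros Hd HQ Hf. destruct (INR_unbounded (2 * D / d)) as [k Hk].
  apply (pigeonhole_R k f d Hd Q (- D)); auto.
  intros n _. specialize (Hf n).
  assert (2 * D < INR k * d).
  { replace (2 * D) with (2 * D / d * d) by (field; lra). apply Rmult_lt_compat_r; lra. }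
  pose proof (Rle_abs (f n)). pose proof (Rle_abs (- f n)). rewrite Rabs_Ropp in *. lra.
Qed.

Lemma Cmod_le_abs (z : C) : Cmod z <= Rabs (fst z) + Rabs (snd z).
Proof.
  pose proof (Cmod_add_le (fst z, 0) (0, snd z)) as H.
  unfold Cadd in H; simpl in H. rewrite Rplus_0_r, Rplus_0_l, <- surjective_pairing in H.
  apply Rle_trans with (1 := H). unfold Cmod; simpl.
  rewrite <- !sqrt_Rsqr_abs. unfold Rsqr.
  replace (fst z * fst z + 0 * 0) with (fst z * fst z) by ring.
  replace (0 * 0 + snd z * snd z) with (snd z * snd z) by ring. lra.
Qed.

Lemma abs_le_Cmod (z : C) : Rabs (fst z) <= Cmod z /\ Rabs (snd z) <= Cmod z.
Proof.
  unfold Cmod. split; rewrite <- sqrt_Rsqr_abs; unfold Rsqr; apply sqrt_le_1_alt; nra.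
Qed.

(** Coordinates are treated one by one, real and imaginary parts separately at accuracy [d / 2];
    each passage to an infinite subset keeps the closeness already gained. *)
Lemma pigeonhole_coords (y : nat -> Seq) (D d : R) (M : nat) : 0 < d ->
  (forall a i, Cmod (y a i) <= D) ->
  exists Q, infinite Q /\
    forall a b, Q a -> Q b -> forall i, (i < M)%nat -> Cmod (Csub (y a i) (y b i)) <= d.
Proof.
  intros Hd HD. induction M as [|M (Q & HQ & H)].
  - exists (fun _ => True); split; [intro k; exists k; auto | intros; lia].
  - destruct (pigeonhole_bounded (fun a => fst (y a M)) D (d / 2) Q) as (Q1 & S1 & I1 & H1);
      [lra | auto | intro n; apply Rle_trans with (2 := HD n M); apply abs_le_Cmod |].
    destruct (pigeonhole_bounded (fun a => snd (y a M)) D (d / 2) Q1) as (Q2 & S2 & I2 & H2);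
      [lra | auto | intro n; apply Rle_trans with (2 := HD n M); apply abs_le_Cmod |].
    exists Q2; split; auto. intros a b Ha Hb i Hi.
    destruct (Nat.eq_dec i M) as [-> | Hne].
    + apply Rle_trans with (1 := Cmod_le_abs _).
      specialize (H1 a b (S2 _ Ha) (S2 _ Hb)). specialize (H2 a b Ha Hb).
      unfold Csub, Cadd, Copp; simpl. unfold Rminus in *. lra.
    + apply H; auto; lia.
Qed.

(** This provides the almost vanishing head of a hump. The lower bound [k] on the indices allows
    fresh ones to be chosen at each use. *)
Lemma close_pair (p : R) (y : nat -> Seq) (A eps : R) (M k : nat) : 0 < p -> 0 < eps ->
  (forall a, pnorm_le p (y a) A) ->
  exists a b, (k <= a)%nat /\ (a < b)%nat /\
    lsum (fun i => modp p (Csub (y a i) (y b i))) (seq 0 M) <= eps.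
Proof.
  intros Hp He Hy.
  assert (HM : 0 < INR M + 1) by (pose proof (pos_INR M); lra).
  (* Each of the [M] coordinates gets an equal share of [eps]; the [+ 1] covers [M = 0]. *)
  assert (Hq : 0 < eps / (INR M + 1)) by (apply Rdiv_lt_0_compat; lra).
  destruct (pigeonhole_coords y (rpow A (1 / p)) (rpow (eps / (INR M + 1)) (1 / p)) M)
    as (Q & HQ & H).
  - now apply rpow_pos.
  - intros a i. pose proof (pnorm_le_ge_0 _ _ _ (Hy a)) as HA.
    apply rpow_le_inv with p; auto using Cmod_ge_0, rpow_ge_0.
    rewrite rpow_root by auto. apply (pnorm_le_coord p (y a) A i (Hy a)).
  - destruct (HQ k) as (a & Ha & Qa). destruct (HQ (S a)) as (b & Hb & Qb).
    exists a, b; repeat split; auto.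
    apply Rle_trans with (lsum (fun _ => eps / (INR M + 1)) (seq 0 M)).
    + apply lsum_le; intros i Hi. apply in_seq in Hi.
      rewrite <- (rpow_root (eps / (INR M + 1)) p) by lra.
      apply rpow_le; [lra|]. split; [apply Cmod_ge_0|]. apply H; auto; lia.
    + rewrite lsum_const, length_seq.
      replace eps with ((INR M + 1) * (eps / (INR M + 1))) at 2 by (field; lra).
      apply Rmult_le_compat_r; lra.
Qed.

(** Past an index where the partial sums come within [eps] of their supremum, at most [eps] is left.
    Starting the tail at [M + K] lets the retained block begin at [M]. *)
Lemma small_tail (p : R) (z : Seq) (c eps : R) (M : nat) : 0 < eps -> pnorm_le p z c ->
  exists K, forall N, lsum (fun i => modp p (z i)) (seq (M + K) N) <= eps.
Proof.
  intros He Hz.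
  destruct (completeness (fun r => exists N, r = lsum (fun i => modp p (z i)) (seq 0 N)))
    as [s [Hub Hlub]].
  - exists c. intros r [N ->]. apply Hz.
  - exists 0, 0%nat; reflexivity.
  - destruct (classic (exists N, s - eps < lsum (fun i => modp p (z i)) (seq 0 N))) as [[K HK] | HK].
    + exists K. intro N.
      assert (U := Hub _ (ex_intro _ (M + K + N)%nat eq_refl)).
      rewrite seq_app, lsum_app in U. simpl in U.
      assert (lsum (fun i => modp p (z i)) (seq 0 K)
              <= lsum (fun i => modp p (z i)) (seq 0 (M + K))).
      { apply lsum_incl; [intro; apply modp_ge_0 | apply seq_NoDup |].
        intros i Hi; apply in_seq in Hi; apply in_seq; lia. }
      lra.
    + exfalso. assert (s <= s - eps); [|lra]. apply Hlub. intros r [N ->].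
      apply Rnot_lt_le; intro L; apply HK; now exists N.
Qed.

Definition block (M M' : nat) (z : Seq) : Seq :=
  fun n => if andb (M <=? n)%nat (n <? M')%nat then z n else C0.
Definition off_block (M M' : nat) (z : Seq) : Seq :=
  fun n => if andb (M <=? n)%nat (n <? M')%nat then C0 else z n.

Lemma block_in (M M' n : nat) (z : Seq) : (M <= n < M')%nat ->
  block M M' z n = z n /\ off_block M M' z n = C0.
Proof.
  intro H. unfold block, off_block.
  destruct (Nat.leb_spec M n), (Nat.ltb_spec n M'); simpl; auto; lia.
Qed.

Lemma block_out (M M' n : nat) (z : Seq) : ~ (M <= n < M')%nat ->
  block M M' z n = C0 /\ off_block M M' z n = z n.
Proof.
  intro H. unfold block, off_block.
  destruct (Nat.leb_spec M n), (Nat.ltb_spec n M'); simpl; auto; lia.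
Qed.

Lemma off_block_small (p : R) (z : Seq) (M K : nat) (e1 e2 : R) :
  lsum (fun i => modp p (z i)) (seq 0 M) <= e1 ->
  (forall N, lsum (fun i => modp p (z i)) (seq (M + K) N) <= e2) ->
  pnorm_le p (off_block M (M + K) z) (e1 + e2).
Proof.
  intros H1 H2 N.
  apply Rle_trans with (lsum (fun n => modp p (off_block M (M + K) z n)) (seq 0 (M + K + N))).
  { apply lsum_incl; [intro; apply modp_ge_0 | apply seq_NoDup |].
    intros i Hi; apply in_seq in Hi; apply in_seq; lia. }
  rewrite !seq_app, !lsum_app; simpl.
  rewrite (lsum_ext _ (fun i => modp p (z i)) (seq 0 M)).
  2: { intros i Hi; apply in_seq in Hi. rewrite (proj2 (block_out M (M + K) i z ltac:(lia))); auto. }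
  rewrite (lsum_ext _ (fun i => 0) (seq M K)).
  2: { intros i Hi; apply in_seq in Hi. rewrite (proj2 (block_in M (M + K) i z ltac:(lia))).
       apply modp_C0. }
  rewrite (lsum_ext _ (fun i => modp p (z i)) (seq (M + K) N)).
  2: { intros i Hi; apply in_seq in Hi. rewrite (proj2 (block_out M (M + K) i z ltac:(lia))); auto. }
  rewrite lsum_const. specialize (H2 N). lra.
Qed.

(** * Gliding humps *)

(* Each hump is a difference [x a - x b] that is small on the coordinates used so far
   (pigeonhole), truncated where its tail becomes small; the errors go into [R]. *)
Lemma gliding_humps (p r A B : R) (x : nat -> Seq) : 0 < p -> 0 < B ->
  (forall l, NoDup (map snd l) ->
     pnorm_le p (fun i => scomb l (fun n => x n i)) (A * rpow (INR (length l)) r)) ->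
  (forall l, NoDup (map snd l) -> forall c,
     pnorm_le p (fun i => scomb l (fun n => x n i)) c -> B * rpow (INR (length l)) r <= c) ->
  forall N rho, 0 < rho -> exists l M U R,
    NoDup (map snd l) /\ length l = (2 * N)%nat /\
    (forall i, scomb l (fun n => x n i) = Cadd (U i) (R i)) /\
    (forall i, (M <= i)%nat -> U i = C0) /\
    INR N * (B * rpow 2 r / 2) <= lsum (fun i => modp p (U i)) (seq 0 M)
      <= INR N * (A * rpow 2 r) /\
    pnorm_le p R rho.
Proof.
  intros Hp HB Hup Hlow. induction N as [|N IH]; intros rho Hrho.
  { exists nil, 0%nat, (fun _ => C0), (fun _ => C0). simpl.
    split; [constructor|]. split; [reflexivity|]. split; [intros; ring|].
    split; [auto|]. split; [lra|]. intro K.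
    rewrite (lsum_ext _ (fun _ => 0)) by (intros; apply modp_C0). rewrite lsum_const; lra. }
  pose proof (rpow_pos 2 p ltac:(lra)) as H2p. pose proof (rpow_pos 2 r ltac:(lra)) as H2r.
  assert (HB2 : 0 < B * rpow 2 r) by now apply Rmult_lt_0_compat.
  (* The same [e] bounds the earlier error, the head and the tail of the new hump. The first bound
     makes the total [2^p * (e + (e + e))] at most [rho]; the second keeps at least half of the new
     hump. *)
  set (e := Rmin (rho / (4 * rpow 2 p)) (B * rpow 2 r / 4)).
  assert (He : 0 < e) by (apply Rmin_glb_lt; [apply Rdiv_lt_0_compat|]; lra).
  assert (He1 : e <= rho / (4 * rpow 2 p)) by apply Rmin_l.
  assert (He2 : e <= B * rpow 2 r / 4) by apply Rmin_r.
  destruct (IH e He) as (l & M & U & R & Hnd & Hlen & Hdec & HU & Hsum & HR).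
  assert (Hx : forall a, pnorm_le p (x a) (A * 1)).
  { intro a. assert (Q := Hup ((true, a) :: nil)). simpl in Q. rewrite rpow_1_l in Q.
    apply pnorm_le_mono with (2 := Q ltac:(repeat constructor; auto)).
    intro i. right; f_equal. ring. }
  (* Searching beyond [list_max] keeps both new indices distinct from the earlier ones. *)
  destruct (close_pair p x (A * 1) e M (S (list_max (map snd l))) Hp He Hx)
    as (a & b & Ha & Hab & Hhead).
  set (z := Ssub (x a) (x b)).
  assert (Hz : forall i, scomb ((true, a) :: (false, b) :: nil) (fun n => x n i) = z i).
  { intro i. unfold z, Ssub. simpl. ring. }
  assert (Hnd2 : NoDup (map snd ((true, a) :: (false, b) :: nil))).
  { simpl. constructor; [simpl; lia|]. constructor; [simpl; tauto | constructor]. }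
  assert (Hzup := Hup _ Hnd2). assert (Hzlow := Hlow _ Hnd2).
  change (INR (length ((true, a) :: (false, b) :: nil))) with 2 in Hzup, Hzlow.
  assert (Ez : (fun i => scomb ((true, a) :: (false, b) :: nil) (fun n => x n i)) = z)
    by (apply functional_extensionality; exact Hz).
  rewrite Ez in Hzup, Hzlow.
  destruct (small_tail p z _ e M He Hzup) as [K HK].
  (* The lower hypothesis for two vectors applies to any bound on [z], in particular to the one that
     allots [e] to the head, [e] to the tail and the exact sum to the block. *)
  assert (Hz1 : B * rpow 2 r <= 2 * e + lsum (fun i => modp p (z i)) (seq M K)).
  { apply Hzlow. intro m.
    apply Rle_trans with (lsum (fun i => modp p (z i)) (seq 0 (M + K + m))).
    { apply lsum_incl; [intro; apply modp_ge_0 | apply seq_NoDup |].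
      intros i Hi; apply in_seq in Hi; apply in_seq; lia. }
    rewrite !seq_app, !lsum_app. specialize (HK m). simpl. unfold z at 1, Ssub. lra. }
  assert (Hz2 : lsum (fun i => modp p (z i)) (seq M K) <= A * rpow 2 r).
  { apply pnorm_le_list; [exact Hzup | apply seq_NoDup]. }
  assert (Hmax : forall c, (S (list_max (map snd l)) <= c)%nat -> ~ In c (map snd l)).
  { intros c Hc Hin.
    assert (Hm := proj1 (list_max_le (map snd l) _) (le_n _)).
    rewrite Forall_forall in Hm. specialize (Hm c Hin). lia. }
  exists ((true, a) :: (false, b) :: l), (M + K)%nat, (Sadd U (block M (M + K) z)),
    (Sadd R (off_block M (M + K) z)).
  split; [|split; [|split; [|split; [|split]]]].
  - simpl. constructor; [simpl; intros [E | E]; [lia | revert E; apply Hmax; lia]|].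
    constructor; [apply Hmax; lia | auto].
  - simpl. rewrite Hlen. lia.
  - intro i. unfold Sadd. simpl. rewrite Hdec. unfold block, off_block.
    destruct (andb _ _); unfold z, Ssub; ring.
  - intros i Hi. unfold Sadd. rewrite HU by lia.
    rewrite (proj1 (block_out M (M + K) i z ltac:(lia))). ring.
  - rewrite seq_app, lsum_app; simpl (0 + M)%nat.
    rewrite (lsum_ext _ (fun i => modp p (U i)) (seq 0 M)).
    2: { intros i Hi; apply in_seq in Hi. unfold Sadd.
         rewrite (proj1 (block_out M (M + K) i z ltac:(lia))). f_equal; ring. }
    rewrite (lsum_ext _ (fun i => modp p (z i)) (seq M K)).
    2: { intros i Hi; apply in_seq in Hi. unfold Sadd.
         rewrite (proj1 (block_in M (M + K) i z ltac:(lia))), HU by lia. f_equal; ring. }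
    rewrite S_INR. lra.
  - apply pnorm_le_weaken with (rpow 2 p * (e + (e + e))).
    + apply Rmult_le_compat_l with (r := 4 * rpow 2 p) in He1; [|lra].
      replace (4 * rpow 2 p * (rho / (4 * rpow 2 p))) with rho in He1 by (field; lra).
      nra.
    + apply pnorm_le_add; [lra | exact HR | now apply off_block_small].
Qed.

(** A sum of [N] disjoint humps has [p]-th power of order [N], while the hypotheses demand order
    [N^r] for the [2N] vectors involved; only [r = 1] reconciles the two. *)
Lemma no_power_growth (p r A B : R) (x : nat -> Seq) : 0 < p -> 0 < r -> r <> 1 -> 0 < B ->
  (forall l, NoDup (map snd l) ->
     pnorm_le p (fun i => scomb l (fun n => x n i)) (A * rpow (INR (length l)) r)) ->
  (forall l, NoDup (map snd l) -> forall c,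
     pnorm_le p (fun i => scomb l (fun n => x n i)) c -> B * rpow (INR (length l)) r <= c) ->
  False.
Proof.
  intros Hp Hr Hr1 HB Hup Hlow.
  pose proof (rpow_pos 2 p ltac:(lra)) as H2p. pose proof (rpow_pos 2 r ltac:(lra)) as H2r.
  assert (HA : 0 <= A).
  { assert (Q := pnorm_le_ge_0 _ _ _
      (Hup ((true, 0%nat) :: nil) ltac:(repeat constructor; auto))).
    simpl in Q. rewrite rpow_1_l in Q. lra. }
  assert (HB2 : 0 < B * rpow 2 r) by now apply Rmult_lt_0_compat.
  assert (HA2 : 0 <= A * rpow 2 r) by (apply Rmult_le_pos; lra).
  set (a := A * rpow 2 r) in *. set (b := B * rpow 2 r) in *.
  (* Both inequalities compare the signed sum [Z] of [2N] vectors with its hump part [U] through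
     [Z = U + R], the error [R] being bounded by 1. One bounds [N^r] by a multiple of [N], the other
     does the converse. *)
  assert (H : forall N, (1 <= N)%nat ->
    b * rpow (INR N) r <= rpow 2 p * (INR N * a + 1) /\
    INR N * (b / 2) <= rpow 2 p * (a * rpow (INR N) r + 1)).
  { intros N HN.
    destruct (gliding_humps p r A B x Hp HB Hup Hlow N 1 ltac:(lra))
      as (l & M & U & R & Hnd & Hlen & Hdec & HU & Hsum & HR).
    fold a b in Hsum.
    assert (Hl2 : rpow (INR (length l)) r = rpow 2 r * rpow (INR N) r).
    { rewrite Hlen, mult_INR, rpow_mult; auto; simpl; [lra | apply pos_INR]. }
    specialize (Hup l Hnd). specialize (Hlow l Hnd).
    rewrite Hl2, <- Rmult_assoc in Hup, Hlow. fold a in Hup. fold b in Hlow.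
    set (Z := fun i => scomb l (fun n => x n i)) in *.
    split.
    - apply Hlow. replace Z with (Sadd U R)
        by (symmetry; apply functional_extensionality; exact Hdec).
      apply pnorm_le_add; [lra | | exact HR].
      intro K. apply Rle_trans with (lsum (fun i => modp p (U i)) (seq 0 (M + K))).
      { apply lsum_incl; [intro; apply modp_ge_0 | apply seq_NoDup |].
        intros i Hi; apply in_seq in Hi; apply in_seq; lia. }
      rewrite seq_app, lsum_app, (lsum_ext _ (fun _ => 0) (seq (0 + M) K)), lsum_const; [lra|].
      intros i Hi; apply in_seq in Hi. rewrite HU by lia. apply modp_C0.
    - apply Rle_trans with (1 := proj1 Hsum).
      apply pnorm_le_list; [|apply seq_NoDup].
      replace U with (Sadd Z (Sscale (Copp C1) R)).
      2: { apply functional_extensionality; intro i. unfold Sadd, Sscale, Z.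
           rewrite Hdec. ring. }
      apply pnorm_le_add; [lra | exact Hup |].
      replace 1 with (modp p (Copp C1) * 1).
      + now apply pnorm_le_scale.
      + change (Copp C1) with (sgn false). rewrite modp_sgn; ring. }
  assert (Hsplit : forall s t u N, u = s + t -> rpow (INR N) u = rpow (INR N) s * rpow (INR N) t).
  { intros s t u N ->. apply rpow_plus, pos_INR. }
  (* For [r < 1] the second inequality fails once [N^(1-r)] exceeds a constant, for [r > 1] the
     first once [N^(r-1)] does. The error 1 is absorbed into [a + 1], because [N^r] and [N] are at
     least 1. *)
  destruct (Rtotal_order r 1) as [L | [E | L]]; [|contradiction|].
  - destruct (rpow_unbounded (1 - r) (rpow 2 p * (a + 1) / (b / 2)) ltac:(lra)) as (N & HN & HNs).
    destruct (H N HN) as [_ H2].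
    pose proof (le_INR _ _ HN) as HN1. simpl in HN1.
    assert (Hr0 : 1 <= rpow (INR N) r).
    { rewrite <- (rpow_1_l r) at 1. apply rpow_le; lra. }
    rewrite <- (rpow_1_r (INR N)) in H2 at 1 by lra.
    rewrite (Hsplit (1 - r) r 1 N) in H2 by ring.
    apply Rmult_lt_compat_r with (r := b / 2) in HNs; [|lra].
    replace (rpow 2 p * (a + 1) / (b / 2) * (b / 2)) with (rpow 2 p * (a + 1)) in HNs
      by (field; lra).
    set (u := rpow (INR N) r) in *. set (v := rpow (INR N) (1 - r)) in *.
    assert (rpow 2 p * (a + 1) * u < v * (b / 2) * u) by (apply Rmult_lt_compat_r; lra).
    assert (rpow 2 p * (a * u + 1) <= rpow 2 p * (a + 1) * u).
    { rewrite Rmult_assoc. apply Rmult_le_compat_l; lra. }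
    lra.
  - destruct (rpow_unbounded (r - 1) (rpow 2 p * (a + 1) / b) ltac:(lra)) as (N & HN & HNs).
    destruct (H N HN) as [H1 _].
    pose proof (le_INR _ _ HN) as HN1. simpl in HN1.
    rewrite (Hsplit (r - 1) 1 r N) in H1 by ring.
    rewrite rpow_1_r in H1 by lra.
    apply Rmult_lt_compat_r with (r := b) in HNs; [|lra].
    replace (rpow 2 p * (a + 1) / b * b) with (rpow 2 p * (a + 1)) in HNs
      by (field; lra).
    set (u := INR N) in *. set (v := rpow u (r - 1)) in *.
    assert (rpow 2 p * (a + 1) * u < v * b * u) by (apply Rmult_lt_compat_r; lra).
    assert (rpow 2 p * (u * a + 1) <= rpow 2 p * (a + 1) * u).
    { rewrite Rmult_assoc. apply Rmult_le_compat_l; lra. }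
    lra.
Qed.

(** * Spatial isometries on counting measure *)

Definition pt (x : nat) : set := fun n => n = x.

(** The complement law at [E] itself gives [S] of the empty set as [F] minus [S E], which is empty;
    intersections are preserved. *)
Lemma mst_disjoint (E F : set) (S : set -> set) : is_bij_mst E F S ->
  forall A B y, sub A E -> sub B E -> (forall n, A n -> ~ B n) -> S A y -> ~ S B y.
Proof.
  intros (H1 & H2 & H3 & H4 & H5 & H6 & H7 & H8 & H9) A B y HA HB HAB SA SB.
  assert (HAB' : sub (fun n => A n /\ B n) E) by (intros n [Hn _]; now apply HA).
  assert (Hy : S (fun n => A n /\ B n) y) by (apply H5; auto).
  assert (HE : sub E E) by (intros n; auto).
  apply (H2 _ (fun n => E n /\ ~ E n)) in Hy; auto.
  - apply H4 in Hy; auto. destruct Hy as [Fy Hy]. apply Hy. now apply H3.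
  - intros n Hn; tauto.
  - intro n; split; [intros [a b]; now destruct (HAB n) | tauto].
Qed.

Lemma mst_nonempty (E F : set) (S : set -> set) : is_bij_mst E F S ->
  forall A x, sub A E -> A x -> exists y, S A y.
Proof.
  intros HS A x HA Ax. apply NNPP; intro H.
  pose proof HS as (H1 & H2 & H3 & H4 & H5 & H6 & H7 & H8 & H9).
  assert (He : sub (fun _ => False) E) by (intros n []).
  apply (H8 A (fun _ => False) HA He) with x; auto.
  intro y; split; intro Hy; [exfalso; apply H; now exists y|].
  exfalso. apply (mst_disjoint E F S HS _ _ y He He (fun n a _ => a) Hy Hy).
Qed.

(** [S (pt x)] is a nonempty part of [S A], which is a single atom. Together with surjectivity this
    makes [S] a bijection of atoms. *)
Lemma mst_point (E F : set) (S : set -> set) (A : set) (x y : nat) :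
  is_bij_mst E F S -> sub A E -> A x -> seteq (S A) (pt y) -> seteq (S (pt x)) (pt y).
Proof.
  intros HS HA Ax HSA.
  pose proof HS as (H1 & H2 & H3 & H4 & H5 & H6 & H7 & H8 & H9).
  assert (Hx : sub (pt x) E) by (intros n ->; auto).
  assert (Hsub : forall z, S (pt x) z -> z = y).
  { intros z Hz. apply HSA.
    assert (Q : S (fun n => A n /\ pt x n) z).
    { apply (H2 (pt x)); auto; [intros n []; auto|].
      intro n; unfold pt; split; [intros -> | intros []]; auto. }
    apply H5 in Q; tauto. }
  destruct (mst_nonempty E F S HS (pt x) x Hx eq_refl) as [z Hz].
  intro n; split; [apply Hsub | intros ->]. rewrite <- (Hsub z Hz) at 1; exact Hz.
Qed.

Lemma mst_preimage (E F : set) (S : set -> set) (y : nat) : is_bij_mst E F S -> F y ->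
  exists x, E x /\ seteq (S (pt x)) (pt y).
Proof.
  intros HS Fy. pose proof HS as (H1 & H2 & H3 & H4 & H5 & H6 & H7 & H8 & H9).
  destruct (H9 (pt y)) as (A & HA & HSA); [intros n ->; auto|].
  assert (exists x, A x) as [x Ax].
  { apply NNPP; intro N.
    assert (Hy : S A y) by (apply HSA; reflexivity).
    apply (mst_disjoint E F S HS A A y HA HA); auto.
    intros n Hn; exfalso; apply N; now exists n. }
  exists x; split; [auto | eapply mst_point; eauto].
Qed.

Lemma mst_image (E F : set) (S : set -> set) (x : nat) : is_bij_mst E F S -> E x ->
  exists y, F y /\ seteq (S (pt x)) (pt y).
Proof.
  intros HS Ex. pose proof HS as (H1 & _).
  assert (Hx : sub (pt x) E) by (intros n ->; auto).
  destruct (mst_nonempty E F S HS (pt x) x Hx eq_refl) as [y Hy].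
  assert (Fy : F y) by (eapply H1; eauto).
  exists y; split; auto. destruct (mst_preimage E F S y HS Fy) as (x' & Ex' & Hx').
  destruct (Nat.eq_dec x' x) as [-> | Hne]; auto. exfalso.
  apply (mst_disjoint E F S HS (pt x) (pt x') y Hx); auto.
  - intros n ->; auto.
  - unfold pt; intros n -> E'; auto.
  - apply Hx'; reflexivity.
Qed.

Lemma Ccv_eventually_const (u : nat -> C) (l c : C) (K : nat) :
  Ccv u l -> (forall k, (K <= k)%nat -> u k = c) -> l = c.
Proof.
  intros Hu Hc.
  assert (H : Cmod (Csub c l) = 0).
  { destruct (Rle_lt_or_eq_dec _ _ (Cmod_ge_0 (Csub c l))) as [L | <-]; auto.
    destruct (Hu _ L) as [N HN].
    specialize (HN (Nat.max N K) (Nat.le_max_l _ _)).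
    rewrite Hc in HN by lia. lra. }
  apply Cmod_eq_0 in H. replace l with (Csub c (Csub c l)) by ring. rewrite H; ring.
Qed.

(* Finite truncations reduce the value of [S_*] to indicators of points;
   continuity along pointwise limits handles the rest. *)
Lemma pushforward_point (E F : set) (S : set -> set) (Sstar : Seq -> Seq) (x y : nat) (xi : Seq) :
  is_bij_mst E F S -> is_pushforward E F S Sstar -> E x -> F y ->
  seteq (S (pt x)) (pt y) -> Sstar xi y = xi x.
Proof.
  intros HS (P1 & P2 & P3 & P4 & P5) Ex Fy HSx.
  assert (Hx : sub (pt x) E) by (intros n ->; auto).
  assert (Hsingle : forall k, Sstar (single k) y = single k x).
  { intro k. set (A := fun n => n = k /\ E n).
    assert (HA : sub A E) by (intros n []; auto).
    destruct (P4 A (single k) HA) with (y := y) as [Q1 Q2]; auto.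
    { intros n En. unfold A, single. destruct (Nat.eq_dec n k); split; tauto. }
    unfold single at 2. destruct (Nat.eq_dec x k) as [-> | Hne].
    - apply Q1. destruct HS as (H1 & H2 & _). apply (H2 (pt k)); auto.
      + intro n; unfold A, pt; split; [intros ->; auto | tauto].
      + apply HSx; reflexivity.
    - apply Q2. intro SA. apply (mst_disjoint E F S HS A (pt x) y HA Hx); auto.
      + unfold A, pt. intros n [-> _] E'; auto.
      + apply HSx; reflexivity. }
  set (trunc := fun k n => if (n <? k)%nat then xi n else C0).
  assert (Htr : forall k, Sstar (trunc k) y = trunc k x).
  { induction k as [|k IH].
    - replace (trunc 0%nat) with (Sscale C0 xi).
      + rewrite P3 by auto. unfold Sscale; ring.
      + apply functional_extensionality; intro n. unfold trunc, Sscale.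
        destruct (Nat.ltb_spec n 0); [lia | ring].
    - replace (trunc (Datatypes.S k)) with (Sadd (trunc k) (Sscale (xi k) (single k))).
      + rewrite P2, P3, IH, Hsingle by auto. reflexivity.
      + apply functional_extensionality; intro n. unfold trunc, Sadd, Sscale, single.
        destruct (Nat.ltb_spec n k), (Nat.ltb_spec n (Datatypes.S k)), (Nat.eq_dec n k);
          subst; try lia; ring. }
  apply (Ccv_eventually_const (fun k => Sstar (trunc k) y) _ _ (Datatypes.S x)).
  - apply P5; auto. intros n _ eps He. exists (Datatypes.S n). intros k Hk.
    unfold trunc. destruct (Nat.ltb_spec n k); [|lia].
    replace (Csub (xi n) (xi n)) with C0 by ring. now rewrite Cmod_C0.
  - intros k Hk. rewrite Htr. unfold trunc. destruct (Nat.ltb_spec x k); [auto | lia].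
Qed.

(** Matching atoms both have mass 1, so the series of [indic (pt y) h], whose only possible nonzero
    term is [h y], has sum 1. *)
Lemma RN_point (E F : set) (S : set -> set) (h : nat -> R) (x y : nat) :
  is_RN E F S h -> E x -> F y -> seteq (S (pt x)) (pt y) -> h y = 1.
Proof.
  intros [_ H] Ex Fy HS.
  destruct (H (pt x) (pt y)) as [Hc _]; [intros n ->; auto | intros n ->; auto | auto |].
  assert (Hs : infinite_sum (indic (pt y) h) (INR 1)).
  { apply Hc. exists (x :: nil). split; [repeat constructor; auto|].
    split; [|reflexivity]. intro m; unfold pt; simpl. intuition. }
  assert (Hind : forall N, sum_f_R0 (indic (pt y) h) N = if le_lt_dec y N then h y else 0).
  { induction N as [|N IH]; simpl; [|rewrite IH]; unfold indic, pt;
      destruct (excluded_middle_informative _) as [<- | Hne];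
      repeat destruct (le_lt_dec _ _); try lia; try lra. }
  apply Rminus_diag_uniq. destruct (Req_dec (h y - 1) 0) as [| Hne]; auto. exfalso.
  destruct (Hs _ (Rabs_pos_lt _ Hne)) as [N HN].
  specialize (HN (Nat.max N y) (Nat.le_max_l _ _)).
  rewrite Hind in HN. destruct (le_lt_dec y (Nat.max N y)); [|lia].
  unfold Rdist in HN. simpl in HN. lra.
Qed.

Lemma spi_point (p : R) (E F : set) (S : set -> set) (Sstar : Seq -> Seq) (g : Seq)
    (h : nat -> R) (s : Op) (xi : Seq) (x y : nat) :
  spi_of p E F S Sstar g h s -> in_lp p xi -> E x -> F y -> seteq (S (pt x)) (pt y) ->
  Cmod (s xi y) = Cmod (xi x).
Proof.
  intros (HS & HP & HR & Hg & Hs) Hxi Ex Fy HSx.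
  rewrite (proj1 (Hs xi Hxi y) Fy), !Cmod_mul, Hg, Cmod_RtoC by auto.
  rewrite (RN_point E F S h x y), rpow_1_l, Rabs_R1 by auto.
  rewrite (pushforward_point E F S Sstar x y xi) by auto. ring.
Qed.

(** Up to unimodular factors, [s] moves the value at [x] to [sg x] and [t] reads it back. Only
    moduli are recorded, since the norm estimates see nothing else. *)
Definition point_map (p : R) (s t : Op) (sg : nat -> nat) : Prop :=
  (forall x y, sg x = sg y -> x = y) /\
  (forall xi, in_lp p xi -> forall x,
     Cmod (t xi x) = Cmod (xi (sg x)) /\ Cmod (s xi (sg x)) = Cmod (xi x)) /\
  (forall xi, in_lp p xi -> forall y, (forall x, y <> sg x) -> s xi y = C0).

Lemma spatial_point_map (p : R) (s t : Op) : 0 < p ->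
  is_spatial_reverse p s t -> is_bdd p s -> op_eq p (Omul t s) Oid ->
  exists sg, point_map p s t sg.
Proof.
  intros Hp (E & F & S & Sstar & g & h & Hs & S' & Sstar' & h' & HS'S & HSS' & Ht) Hb Hid.
  assert (Hlp : forall xi, in_lp p xi -> in_lp p (s xi)).
  { intros xi [b Hxi]. destruct Hb as (_ & _ & M & HM & Hb).
    exists (M * b). apply Hb; auto. now exists b. }
  (* Off [E] the operator [t] produces zeros, whereas [t s] must return the basis vector at [x]. *)
  assert (HE : forall x, E x).
  { intro x. apply NNPP; intro Ex.
    assert (Hd := Hid (single x) (in_lp_single p x Hp) x).
    destruct Ht as (_ & _ & _ & _ & Ht).
    unfold Omul, Oid in Hd. rewrite (proj2 (Ht _ (Hlp _ (in_lp_single p x Hp)) x) Ex) in Hd.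
    unfold single in Hd. destruct (Nat.eq_dec x x); [|contradiction].
    injection Hd; lra. }
  pose proof Hs as (HS & _). pose proof Ht as (HS' & _).
  destruct (choice (fun x y => F y /\ seteq (S (pt x)) (pt y))) as [sg Hsg].
  { intro x. now apply mst_image with E. }
  assert (Hsub : forall x, sub (pt x) E) by (intros x n _; apply HE).
  exists sg; split; [|split].
  - intros x y Exy.
    destruct HS as (_ & _ & _ & _ & _ & _ & _ & H8 & _).
    apply (H8 (pt x) (pt y)); auto; [|reflexivity].
    intro n. rewrite (proj2 (Hsg x) n), (proj2 (Hsg y) n), Exy. tauto.
  - intros xi Hxi x. destruct (Hsg x) as [Fy Hy]. split.
    (* The system of [t] runs from [F] to [E], so the matching of atoms needed is
       [S' (pt (sg x)) = pt x]; it comes from [S' (S (pt x)) = pt x]. *)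
    + eapply spi_point; eauto.
      destruct HS' as (_ & H2 & _). intro n.
      rewrite <- (HS'S (pt x) (Hsub x) n). apply H2; [intros m ->; auto | | ].
      * intros m Hm. apply Hy in Hm. rewrite Hm; auto.
      * intro m. symmetry; apply Hy.
    + eapply spi_point; eauto.
  - intros xi Hxi y Hy. destruct Hs as (_ & _ & _ & _ & Hs). apply (Hs xi Hxi y). intro Fy.
    destruct (mst_preimage E F S y HS Fy) as (x & Ex & Hx).
    apply (Hy x). symmetry. apply Hx. apply (proj2 (Hsg x)). reflexivity.
Qed.

(** If [sg x = sg' y], then [t] applied to [s' (single y)] has modulus 1 at [x], against
    [t s' = 0]. *)
Lemma point_map_disjoint (p : R) (s t s' t' : Op) (sg sg' : nat -> nat) : 0 < p ->
  is_bdd p s' -> point_map p s t sg -> point_map p s' t' sg' ->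
  op_eq p (Omul t s') Ozero -> forall x y, sg x <> sg' y.
Proof.
  intros Hp Hb (_ & H1 & _) (_ & H2 & _) H0 x y E.
  assert (Hy := in_lp_single p y Hp).
  assert (Hsy : in_lp p (s' (single y))).
  { destruct Hy as [b Hy]. destruct Hb as (_ & _ & M & HM & Hb).
    exists (M * b). apply Hb; auto. now exists b. }
  assert (Q := proj1 (H1 _ Hsy x)).
  replace (t (s' (single y)) x) with C0 in Q by (symmetry; apply (H0 _ Hy x)).
  rewrite E, (proj2 (H2 _ Hy y)) in Q. unfold single in Q.
  destruct (Nat.eq_dec y y); [|contradiction].
  rewrite Cmod_C0 in Q. change C1 with (RtoC 1) in Q. rewrite Cmod_RtoC, Rabs_R1 in Q. lra.
Qed.

(** * Words in the generators *)

(** Here [m] bounds the [p]-th power of the operator norm, to match [pnorm_le]. *)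
Definition opnormp_le (p : R) (T : Op) (m : R) : Prop :=
  forall x c, pnorm_le p x c -> pnorm_le p (T x) (m * c).

Lemma opnormp_le_norm (p : R) (T : Op) (m : R) : 0 < p -> 0 <= m -> opnormp_le p T m ->
  forall x b, lp_norm_le p x b -> lp_norm_le p (T x) (rpow m (1 / p) * b).
Proof.
  intros Hp Hm H x b Hx. apply lp_norm_leE in Hx. destruct Hx as [Hb Hx].
  apply lp_norm_leE. split; [apply Rmult_le_pos; auto using rpow_ge_0|].
  rewrite rpow_mult, rpow_root by auto using rpow_ge_0. now apply H.
Qed.

Lemma norm_opnormp_le (p : R) (T : Op) (M : R) : 0 < p -> 0 <= M ->
  (forall x, in_lp p x -> forall b, lp_norm_le p x b -> lp_norm_le p (T x) (M * b)) ->
  opnormp_le p T (rpow M p).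
Proof.
  intros Hp HM H x c Hx. pose proof (pnorm_le_ge_0 _ _ _ Hx) as Hc.
  assert (Q := H x (pnorm_le_in_lp p x c Hp Hx) _ (pnorm_le_root p x c Hp Hx)).
  apply lp_norm_leE in Q. rewrite rpow_mult, rpow_root in Q by auto using rpow_ge_0.
  apply Q.
Qed.

Lemma is_bdd_opnormp (p : R) (T : Op) : 0 < p -> is_bdd p T ->
  exists m, 0 <= m /\ opnormp_le p T m.
Proof.
  intros Hp (_ & _ & M & HM & H). exists (rpow M p). split; [apply rpow_ge_0|].
  now apply norm_opnormp_le.
Qed.

Lemma is_bdd_in_lp (p : R) (T : Op) (x : Seq) : is_bdd p T -> in_lp p x -> in_lp p (T x).
Proof.
  intros (_ & _ & M & HM & H) Hx. destruct (Hx) as [b Hb]. exists (M * b). now apply H.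
Qed.

Lemma is_bdd_add (p : R) (T : Op) (x y : Seq) : is_bdd p T ->
  in_lp p x -> in_lp p y -> T (Sadd x y) = Sadd (T x) (T y).
Proof. intros (H & _) Hx Hy. apply functional_extensionality. exact (H x y Hx Hy). Qed.

Lemma is_bdd_scale (p : R) (T : Op) (c : C) (x : Seq) : is_bdd p T ->
  in_lp p x -> T (Sscale c x) = Sscale c (T x).
Proof. intros (_ & H & _) Hx. apply functional_extensionality. exact (H c x Hx). Qed.

Lemma is_bdd_intro (p : R) (T : Op) (m : R) : 0 < p -> 0 <= m ->
  (forall x y, in_lp p x -> in_lp p y -> T (Sadd x y) = Sadd (T x) (T y)) ->
  (forall c x, in_lp p x -> T (Sscale c x) = Sscale c (T x)) ->
  opnormp_le p T m -> is_bdd p T.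
Proof.
  intros Hp Hm H1 H2 H3. split; [|split].
  - intros x y Hx Hy n. now rewrite H1.
  - intros c x Hx n. now rewrite H2.
  - exists (rpow m (1 / p)). split; [apply rpow_ge_0|].
    intros x _. now apply opnormp_le_norm.
Qed.

Lemma eval_bdd (p : R) (k : cuntz_kind) (Ss Tt : nat -> Op) (a : term) : 0 < p ->
  is_rep p k Ss Tt -> term_ok k a -> is_bdd p (eval Ss Tt a).
Proof.
  intros Hp Hrep. pose proof Hrep as (Hgen & _).
  induction a as [c | j | j | a IHa b IHb | a IHa b IHb]; simpl; intro Hok.
  - apply is_bdd_intro with (modp p c); auto using modp_ge_0.
    + intros x y _ _; apply functional_extensionality; intro n.
      unfold Oscale, Oid, Sscale, Sadd; ring.
    + intros c' x _; apply functional_extensionality; intro n.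
      unfold Oscale, Oid, Sscale; ring.
    + intros x d Hx. now apply pnorm_le_scale.
  - now apply Hgen.
  - now apply Hgen.
  - destruct Hok as [Ha Hb]; specialize (IHa Ha); specialize (IHb Hb).
    destruct (is_bdd_opnormp p _ Hp IHa) as (ma & Hma & Na).
    destruct (is_bdd_opnormp p _ Hp IHb) as (mb & Hmb & Nb).
    apply is_bdd_intro with (rpow 2 p * (ma + mb)); auto.
    + apply Rmult_le_pos; [apply rpow_ge_0 | lra].
    + intros x y Hx Hy. unfold Oadd.
      rewrite (is_bdd_add p _ x y IHa Hx Hy), (is_bdd_add p _ x y IHb Hx Hy).
      apply functional_extensionality; intro n. unfold Sadd; ring.
    + intros c x Hx. unfold Oadd.
      rewrite (is_bdd_scale p _ c x IHa Hx), (is_bdd_scale p _ c x IHb Hx).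
      apply functional_extensionality; intro n. unfold Sadd, Sscale; ring.
    + intros x c Hx. unfold Oadd.
      replace (rpow 2 p * (ma + mb) * c) with (rpow 2 p * (ma * c + mb * c)) by ring.
      apply pnorm_le_add; auto; lra.
  - destruct Hok as [Ha Hb]; specialize (IHa Ha); specialize (IHb Hb).
    destruct (is_bdd_opnormp p _ Hp IHa) as (ma & Hma & Na).
    destruct (is_bdd_opnormp p _ Hp IHb) as (mb & Hmb & Nb).
    apply is_bdd_intro with (ma * mb); auto.
    + now apply Rmult_le_pos.
    + intros x y Hx Hy. unfold Omul.
      rewrite (is_bdd_add p _ x y IHb Hx Hy).
      apply (is_bdd_add p); eauto using is_bdd_in_lp.
    + intros c x Hx. unfold Omul.
      rewrite (is_bdd_scale p _ c x IHb Hx).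
      apply (is_bdd_scale p); eauto using is_bdd_in_lp.
    + intros x c Hx. unfold Omul. rewrite Rmult_assoc. auto.
Qed.

Lemma eval_closure_img (p : R) (k : cuntz_kind) (Ss Tt : nat -> Op) (a : term) : 0 < p ->
  is_rep p k Ss Tt -> term_ok k a -> closure_img p k Ss Tt (eval Ss Tt a).
Proof.
  intros Hp Hrep Hok. split; [eapply eval_bdd; eauto|].
  intros eps He. exists a. split; auto. exists 0. split; [lra|].
  intros x _ b _. rewrite Rmult_0_l. apply lp_norm_leE. split; [lra|].
  intro N. rewrite (lsum_ext _ (fun _ => 0)).
  - rewrite lsum_const, rpow_0; lra.
  - intros n _. unfold Osub, Ssub.
    replace (Csub _ _) with C0 by ring. apply modp_C0.
Qed.

Fixpoint vterm (n : nat) : term :=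
  match n with O => tS 1 | S m => tmul (tS 0) (vterm m) end.
Fixpoint wterm (n : nat) : term :=
  match n with O => tT 1 | S m => tmul (wterm m) (tT 0) end.

Definition signed_sum (l : list (bool * nat)) (X : nat -> term) : term :=
  fold_right (fun e acc => tadd (tmul (tconst (sgn (fst e))) (X (snd e))) acc) (tconst C0) l.

Lemma in_range_01 (k : cuntz_kind) : kind_ok k -> in_range k 0 /\ in_range k 1.
Proof. destruct k; simpl; lia || auto. Qed.

Lemma vterm_ok (k : cuntz_kind) (n : nat) : kind_ok k -> term_ok k (vterm n).
Proof. intro H; apply in_range_01 in H; induction n; simpl; tauto. Qed.

Lemma wterm_ok (k : cuntz_kind) (n : nat) : kind_ok k -> term_ok k (wterm n).
Proof. intro H; apply in_range_01 in H; induction n; simpl; tauto. Qed.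

Lemma signed_sum_ok (k : cuntz_kind) (l : list (bool * nat)) (X : nat -> term) :
  (forall n, term_ok k (X n)) -> term_ok k (signed_sum l X).
Proof. intro H; induction l; simpl; auto. Qed.

Lemma eval_signed_sum (Ss Tt : nat -> Op) (l : list (bool * nat)) (X : nat -> term)
    (x : Seq) (i : nat) :
  eval Ss Tt (signed_sum l X) x i = scomb l (fun n => eval Ss Tt (X n) x i).
Proof.
  induction l as [|e l IH]; simpl.
  - unfold Oscale, Oid, Sscale; ring.
  - rewrite <- IH. reflexivity.
Qed.

Lemma in_lp_zero (p : R) : 0 < p -> in_lp p Szero.
Proof.
  intro Hp. apply (pnorm_le_in_lp p _ 0 Hp). intro N.
  rewrite (lsum_ext _ (fun _ => 0)) by (intros; apply modp_C0). rewrite lsum_const; lra.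
Qed.

Lemma is_bdd_zero (p : R) (T : Op) : 0 < p -> is_bdd p T -> T Szero = Szero.
Proof.
  intros Hp HT. replace Szero with (Sscale C0 Szero) at 1.
  - rewrite (is_bdd_scale p) by auto using in_lp_zero.
    apply functional_extensionality; intro n. unfold Sscale, Szero; ring.
  - apply functional_extensionality; intro n. unfold Sscale, Szero; ring.
Qed.

Lemma scomb_in_lp (p : R) (l : list (bool * nat)) (X : nat -> Seq) : 0 < p ->
  (forall n, in_lp p (X n)) -> in_lp p (fun i => scomb l (fun n => X n i)).
Proof.
  intros Hp HX. induction l as [|e l IH]; simpl; [now apply in_lp_zero|].
  exact (in_lp_add p _ _ Hp (in_lp_scale p (sgn (fst e)) _ Hp (HX (snd e))) IH).
Qed.

Lemma is_bdd_scomb (p : R) (T : Op) (l : list (bool * nat)) (X : nat -> Seq) : 0 < p ->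
  is_bdd p T -> (forall n, in_lp p (X n)) ->
  forall i, T (fun i => scomb l (fun n => X n i)) i = scomb l (fun n => T (X n) i).
Proof.
  intros Hp HT HX. induction l as [|e l IH]; intro i; simpl.
  - change (T Szero i = C0). now rewrite (is_bdd_zero p).
  - rewrite <- IH.
    assert (Q := is_bdd_add p T _ _ HT (in_lp_scale p (sgn (fst e)) _ Hp (HX (snd e)))
                   (scomb_in_lp p l X Hp HX)).
    rewrite (is_bdd_scale p) in Q by auto. exact (equal_f Q i).
Qed.

(** Pairs [t_0 s_0] cancel in the middle until one word is down to its last letter. What meets there
    is [t_1 s_1 = 1] if the lengths agree, and [t_1 s_0 = 0] or [t_0 s_1 = 0] otherwise. *)
Lemma wterm_vterm (p : R) (k : cuntz_kind) (Ss Tt : nat -> Op) (n m : nat) (x : Seq) :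
  0 < p -> kind_ok k -> is_rep p k Ss Tt -> in_lp p x ->
  eval Ss Tt (wterm n) (eval Ss Tt (vterm m) x) = if Nat.eq_dec n m then x else Szero.
Proof.
  intros Hp Hk Hrep Hx. destruct (in_range_01 k Hk) as [H0 H1].
  pose proof Hrep as (_ & Hid & Hz & _).
  assert (Hv : forall m, in_lp p (eval Ss Tt (vterm m) x)).
  { intro j. apply is_bdd_in_lp; auto. eapply eval_bdd; eauto using vterm_ok. }
  revert m; induction n as [|n IH]; intros [|m]; simpl; unfold Omul.
  - apply functional_extensionality; intro i. now apply Hid.
  - apply functional_extensionality; intro i. apply (Hz 1%nat 0%nat); auto.
  - replace (Tt 0%nat (Ss 1%nat x)) with Szero.
    + apply (is_bdd_zero p); auto. eapply eval_bdd; eauto using wterm_ok.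
    + symmetry; apply functional_extensionality; intro i. apply (Hz 0%nat 1%nat); auto.
  - replace (Tt 0%nat (Ss 0%nat (eval Ss Tt (vterm m) x))) with (eval Ss Tt (vterm m) x).
    + rewrite IH. destruct (Nat.eq_dec n m), (Nat.eq_dec (S n) (S m)); auto; lia.
    + symmetry; apply functional_extensionality; intro i. apply (Hid 0%nat); auto.
Qed.

Lemma scomb_zero (l : list (bool * nat)) (X : nat -> C) :
  (forall n, In n (map snd l) -> X n = C0) -> scomb l X = C0.
Proof.
  induction l as [|e l IH]; simpl; intro H; auto.
  rewrite IH by auto. rewrite H by auto. ring.
Qed.

Lemma sgn_sqr (b : bool) : Cmul (sgn b) (sgn b) = C1.
Proof. destruct b; unfold sgn; ring. Qed.

Lemma scomb_delta (l : list (bool * nat)) (z : C) : NoDup (map snd l) ->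
  scomb l (fun n => scomb l (fun m => if Nat.eq_dec n m then z else C0))
  = Cmul (RtoC (INR (length l))) z.
Proof.
  intro Hl.
  (* The outer list is separated from the inner one, so that the induction shortens only the outer
     sum. Each outer entry meets itself once in [l], and its sign is squared away. *)
  enough (H : forall k, (forall e, In e k -> In e l) ->
    scomb k (fun n => scomb l (fun m => if Nat.eq_dec n m then z else C0))
    = Cmul (RtoC (INR (length k))) z) by auto.
  assert (Hin : forall e, In e l ->
    scomb l (fun m => if Nat.eq_dec (snd e) m then z else C0) = Cmul (sgn (fst e)) z).
  { induction l as [|f l IH]; simpl in *; intros e He; [contradiction|].
    inversion Hl as [|f' l' Hf Hl']; subst.
    destruct He as [-> | He].
    - rewrite scomb_zero.
      + destruct (Nat.eq_dec (snd e) (snd e)); [ring | contradiction].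
      + intros n Hn. destruct (Nat.eq_dec (snd e) n); [congruence | auto].
    - rewrite IH by auto. destruct (Nat.eq_dec (snd e) (snd f)) as [E | _]; [|ring].
      exfalso; apply Hf. rewrite <- E. now apply in_map. }
  induction k as [|e k IH]; intro Hk.
  - simpl. unfold Cmul, RtoC, C0; simpl. f_equal; ring.
  - change (length (e :: k)) with (S (length k)). rewrite S_INR. simpl.
    rewrite IH, Hin by (intros; apply Hk; simpl; auto).
    replace (Cmul (sgn (fst e)) (Cmul (sgn (fst e)) z))
      with (Cmul (Cmul (sgn (fst e)) (sgn (fst e))) z) by ring.
    rewrite sgn_sqr. unfold Cmul, Cadd, C1, RtoC; simpl. f_equal; ring.
Qed.

(** Expanding the product gives the double sum of [scomb_delta]. The factor [INR (length l)] is what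
    turns an upper bound on the [w]-sum into a lower bound on the [v]-sum. *)
Lemma wsum_vsum (p : R) (k : cuntz_kind) (Ss Tt : nat -> Op) (l : list (bool * nat)) :
  0 < p -> kind_ok k -> is_rep p k Ss Tt -> NoDup (map snd l) ->
  op_eq p (Omul (eval Ss Tt (signed_sum l wterm)) (eval Ss Tt (signed_sum l vterm)))
    (Oscale (RtoC (INR (length l))) Oid).
Proof.
  intros Hp Hk Hrep Hl x Hx i. unfold Omul. rewrite eval_signed_sum.
  unfold Oscale, Oid, Sscale. rewrite <- (scomb_delta l (x i) Hl).
  f_equal. apply functional_extensionality; intro n.
  replace (eval Ss Tt (signed_sum l vterm) x)
    with (fun i => scomb l (fun n => eval Ss Tt (vterm n) x i))
    by (apply functional_extensionality; intro; symmetry; apply eval_signed_sum).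
  rewrite (is_bdd_scomb p); auto.
  - f_equal. apply functional_extensionality; intro m.
    rewrite (wterm_vterm p k) by auto. now destruct (Nat.eq_dec n m).
  - eapply eval_bdd; eauto using wterm_ok.
  - intro m. apply is_bdd_in_lp; auto. eapply eval_bdd; eauto using vterm_ok.
Qed.

(** * Point maps of words and norm bounds for signed sums *)

Fixpoint word_map (sg0 sg1 : nat -> nat) (n x : nat) : nat :=
  match n with O => sg1 x | S m => sg0 (word_map sg0 sg1 m x) end.

(** As the ranges of [sg0] and [sg1] are disjoint, the number of leading [sg0]'s can be read off
    from the image point. *)
Lemma word_map_inj (sg0 sg1 : nat -> nat) :
  (forall x y, sg0 x = sg0 y -> x = y) -> (forall x y, sg1 x = sg1 y -> x = y) ->
  (forall x y, sg0 x <> sg1 y) ->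
  forall n m x y, word_map sg0 sg1 n x = word_map sg0 sg1 m y -> n = m /\ x = y.
Proof.
  intros I0 I1 D. induction n as [|n IH]; intros [|m] x y E; simpl in E.
  - auto.
  - symmetry in E; now apply D in E.
  - now apply D in E.
  - apply I0, IH in E. intuition.
Qed.

(** Coordinates of [s x] are pulled back along the injection [sg], and those outside its range
    vanish. The induction runs over arbitrary duplicate-free lists, because the pulled-back
    coordinates form no initial segment. *)
Lemma isometry_opnormp (p : R) (s t : Op) (sg : nat -> nat) : 0 < p ->
  point_map p s t sg -> opnormp_le p s 1.
Proof.
  intros Hp (Hinj & Hpt & Hoff) x c Hx N. rewrite Rmult_1_l.
  assert (Hlp := pnorm_le_in_lp p x c Hp Hx).
  enough (H : forall L, NoDup L -> exists L', NoDup L' /\ (forall a, In a L' -> In (sg a) L) /\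
    lsum (fun n => modp p (s x n)) L = lsum (fun n => modp p (x n)) L').
  { destruct (H (seq 0 N) (seq_NoDup N 0)) as (L' & HL' & _ & ->). now apply pnorm_le_list. }
  induction 1 as [|y L Hy HL (L' & HL' & Hin & E)].
  - exists nil. repeat split; auto; constructor.
  - destruct (classic (exists a, y = sg a)) as [[a ->] | Hr].
    + exists (a :: L'). split; [|split].
      * constructor; auto.
      * intros b [-> | Hb]; simpl; auto.
      * simpl. rewrite E. unfold modp. now rewrite (proj2 (Hpt x Hlp a)).
    + exists L'. split; [auto|split]; [simpl; auto|].
      simpl. rewrite (Hoff x Hlp y), modp_C0; [lra|].
      intros a ->; apply Hr; now exists a.
Qed.

Lemma modp_scomb_disjoint (p : R) (l : list (bool * nat)) (X : nat -> C) :
  NoDup (map snd l) -> (forall n m, X n <> C0 -> X m <> C0 -> n = m) ->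
  modp p (scomb l X) <= lsum (fun e => modp p (X (snd e))) l.
Proof.
  intros Hl HX. induction l as [|e l IH]; simpl; [rewrite modp_C0; lra|].
  inversion Hl as [|e' l' He Hl']; subst.
  destruct (excluded_middle_informative (X (snd e) = C0)) as [E | E].
  - rewrite E. replace (Cadd _ _) with (scomb l X) by ring.
    pose proof (modp_ge_0 p C0). specialize (IH Hl'). lra.
  - rewrite scomb_zero.
    + replace (Cadd _ _) with (Cmul (sgn (fst e)) (X (snd e))) by ring.
      rewrite modp_mul, modp_sgn.
      pose proof (lsum_nonneg (fun e => modp p (X (snd e))) l (fun _ => modp_ge_0 _ _)). lra.
    + intros n Hn. apply NNPP; intro Q. apply He. now rewrite (HX (snd e) n).
Qed.

Lemma Cmod_scomb_le (l : list (bool * nat)) (X : nat -> C) :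
  Cmod (scomb l X) <= lsum (fun e => Cmod (X (snd e))) l.
Proof.
  induction l as [|e l IH]; simpl; [rewrite Cmod_C0; lra|].
  apply Rle_trans with (1 := Cmod_add_le _ _). rewrite Cmod_mul, Cmod_sgn. lra.
Qed.

(** Distinct [v n] have disjoint ranges of coordinates, so at each coordinate at most one term
    survives and the [p]-th powers add up, each being at most that of [x]. *)
Lemma vsum_opnormp (p : R) (k : cuntz_kind) (Ss Tt : nat -> Op) (sg0 sg1 : nat -> nat)
    (l : list (bool * nat)) : 0 < p -> kind_ok k -> is_rep p k Ss Tt ->
  point_map p (Ss 0%nat) (Tt 0%nat) sg0 -> point_map p (Ss 1%nat) (Tt 1%nat) sg1 ->
  (forall x y, sg0 x <> sg1 y) -> NoDup (map snd l) ->
  opnormp_le p (eval Ss Tt (signed_sum l vterm)) (INR (length l)).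
Proof.
  intros Hp Hk Hrep H0 H1 D Hl x c Hx N.
  assert (Hlp := pnorm_le_in_lp p x c Hp Hx).
  assert (Hv : forall n, pnorm_le p (eval Ss Tt (vterm n) x) c).
  { induction n as [|n IH]; simpl; unfold Omul; rewrite <- (Rmult_1_l c);
      eapply isometry_opnormp; eauto. }
  assert (Hrange : forall n y, eval Ss Tt (vterm n) x y <> C0 ->
    exists z, y = word_map sg0 sg1 n z).
  { induction n as [|n IH]; intros y Hy; simpl in *; unfold Omul in *.
    - apply NNPP; intro Q. apply Hy. apply H1; auto. intros z ->; apply Q; now exists z.
    - assert (Hn := pnorm_le_in_lp p _ c Hp (Hv n)).
      destruct (classic (exists z, y = sg0 z)) as [[z ->] | Q].
      + destruct (IH z) as [z' ->]; [|now exists z'].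
        intro E. apply Hy. apply Cmod_eq_0.
        rewrite (proj2 (proj1 (proj2 H0) _ Hn z)), E. apply Cmod_C0.
      + exfalso. apply Hy. apply H0; auto. intros z ->; apply Q; now exists z. }
  rewrite <- lsum_const.
  apply Rle_trans with (lsum (fun i => lsum (fun e => modp p (eval Ss Tt (vterm (snd e)) x i)) l)
                          (seq 0 N)).
  - apply lsum_le; intros i _. rewrite eval_signed_sum. apply modp_scomb_disjoint; auto.
    intros n m Hn Hm. destruct (Hrange n i Hn) as [z Hz], (Hrange m i Hm) as [z' Hz'].
    rewrite Hz in Hz'. apply word_map_inj in Hz'; [tauto | apply H0 | apply H1 | auto].
  - rewrite lsum_swap. apply lsum_le; intros e _. apply Hv.
Qed.

(** Here several terms may meet in one coordinate, and Jensen costs the factor [n^(p-1)]. The values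
    of [x] that are read in the process all sit at different coordinates, so their [p]-th powers sum
    to at most [c]. *)
Lemma wsum_opnormp (p : R) (k : cuntz_kind) (Ss Tt : nat -> Op) (sg0 sg1 : nat -> nat)
    (l : list (bool * nat)) : 1 <= p -> kind_ok k -> is_rep p k Ss Tt ->
  point_map p (Ss 0%nat) (Tt 0%nat) sg0 -> point_map p (Ss 1%nat) (Tt 1%nat) sg1 ->
  (forall x y, sg0 x <> sg1 y) -> NoDup (map snd l) ->
  opnormp_le p (eval Ss Tt (signed_sum l wterm)) (rpow (INR (length l)) (p - 1)).
Proof.
  intros Hp1 Hk Hrep H0 H1 D Hl x c Hx N.
  assert (Hp : 0 < p) by lra.
  assert (Hlp := pnorm_le_in_lp p x c Hp Hx).
  assert (Hw : forall n x i, in_lp p x ->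
    Cmod (eval Ss Tt (wterm n) x i) = Cmod (x (word_map sg0 sg1 n i))).
  { induction n as [|n IH]; intros z i Hz; simpl; unfold Omul.
    - now apply H1.
    - rewrite IH; [now apply H0|]. apply is_bdd_in_lp; auto. apply Hrep.
      now apply in_range_01. }
  apply Rle_trans with (lsum (fun i => rpow (INR (length l)) (p - 1) *
    lsum (fun e => modp p (x (word_map sg0 sg1 (snd e) i))) l) (seq 0 N)).
  - apply lsum_le; intros i _. rewrite eval_signed_sum. unfold modp at 1.
    eapply Rle_trans; [apply rpow_le; [lra|]; split; [apply Cmod_ge_0 | apply Cmod_scomb_le]|].
    eapply Rle_trans; [apply rpow_lsum_le; auto; intro; apply Cmod_ge_0|].
    right. f_equal. apply lsum_ext; intros e _. unfold modp. now rewrite Hw.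
  - rewrite lsum_scal. apply Rmult_le_compat_l; [apply rpow_ge_0|].
    rewrite lsum_swap.
    (* The clause recording which word each point of [L] comes from keeps the points of the next
       word apart from those already listed. *)
    enough (H : exists L, NoDup L /\
        (forall y, In y L -> exists n i, In n (map snd l) /\ y = word_map sg0 sg1 n i) /\
        lsum (fun e => lsum (fun i => modp p (x (word_map sg0 sg1 (snd e) i))) (seq 0 N)) l
        = lsum (fun y => modp p (x y)) L).
    { destruct H as (L & HL & _ & ->). now apply pnorm_le_list. }
    induction l as [|e l IH]; simpl.
    + exists nil. repeat split; [constructor | intros y []].
    + inversion Hl as [|e' l' He Hl']; subst.
      destruct (IH Hl') as (L & HL & Hin & E).
      assert (I := word_map_inj sg0 sg1 (proj1 H0) (proj1 H1) D).
      exists (map (word_map sg0 sg1 (snd e)) (seq 0 N) ++ L). split; [|split].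
      * apply NoDup_app; auto.
        -- apply FinFun.Injective_map_NoDup; [|apply seq_NoDup].
           intros a b Q. now apply I in Q.
        -- intros y Hy Hy'. apply in_map_iff in Hy. destruct Hy as (a & <- & _).
           destruct (Hin _ Hy') as (n & i & Hn & Q). apply I in Q. destruct Q as [<- _]. auto.
      * intros y Hy. apply in_app_or in Hy. destruct Hy as [Hy | Hy].
        -- apply in_map_iff in Hy. destruct Hy as (a & <- & _). exists (snd e), a; auto.
        -- destruct (Hin y Hy) as (n & i & Hn & ->). exists n, i; auto.
      * rewrite lsum_app, lsum_map, E. reflexivity.
Qed.

(** * Continuous homomorphisms *)

(** Scaling to norm at most [d / 2] gives the strict inequality that continuity at [Ozero] asks
    for. *)
Lemma opnormp_le_scaled (p : R) (T : Op) (m d : R) : 0 < p -> 0 < m -> 0 < d ->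
  opnormp_le p T m ->
  opnorm_lt p (Osub (Oscale (RtoC (d / 2 / rpow m (1 / p))) T) Ozero) d.
Proof.
  intros Hp Hm Hd HT. exists (d / 2). split; [lra|]. intros x _ b Hx.
  apply lp_norm_leE in Hx. destruct Hx as [Hb Hx].
  apply lp_norm_leE. split; [nra|].
  assert (Hr := rpow_pos m (1 / p) Hm).
  set (u := d / 2 / rpow m (1 / p)).
  assert (Hu : 0 < u) by (apply Rdiv_lt_0_compat; lra).
  replace (d / 2 * b) with (u * (rpow m (1 / p) * b)) by (unfold u; field; lra).
  assert (Hrb : 0 <= rpow m (1 / p) * b) by (apply Rmult_le_pos; lra).
  rewrite !rpow_mult, rpow_root by lra.
  assert (Q := pnorm_le_scale p (RtoC u) _ _ (HT _ _ Hx)).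
  unfold modp at 1 in Q. rewrite Cmod_RtoC, Rabs_pos_eq in Q by lra.
  apply pnorm_le_mono with (2 := Q). intro n. right. f_equal.
  unfold Osub, Oscale, Ozero, Ssub, Szero. ring.
Qed.

(** The usual passage from continuity at 0 to boundedness, with [K = (2/d)^p2]. The exponent [p2/p1]
    converts a [p1]-th power of a norm into a [p2]-th power. *)
Lemma cont_hom_bounded (p1 p2 : R) (B : Op -> Prop) (phi : Op -> Op) : 0 < p1 -> 0 < p2 ->
  is_cont_hom p1 p2 B phi -> B Ozero ->
  exists K, 0 < K /\ forall T m, B T -> (forall c, B (Oscale c T)) -> 0 < m -> opnormp_le p1 T m ->
    opnormp_le p2 (phi T) (K * rpow m (1 / p1 * p2)).
Proof.
  intros Hp1 Hp2 (_ & _ & _ & _ & Hscal & Hcont) B0.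
  destruct (Hcont Ozero B0 1 ltac:(lra)) as (d & Hd & H).
  exists (rpow (/ (d / 2)) p2). split; [apply rpow_pos; apply Rinv_0_lt_compat; lra|].
  intros T m BT BS Hm HT x c Hx.
  assert (Hlp := pnorm_le_in_lp p2 x c Hp2 Hx).
  assert (Hr := rpow_pos m (1 / p1) Hm).
  set (u := d / 2 / rpow m (1 / p1)).
  assert (Hu : 0 < u) by (apply Rdiv_lt_0_compat; lra).
  destruct (H _ (BS (RtoC u)) (opnormp_le_scaled p1 T m d Hp1 Hm Hd HT))
    as (c0 & Hc0 & Q).
  specialize (Q x Hlp _ (pnorm_le_root p2 x c Hp2 Hx)).
  apply lp_norm_leE in Q. destruct Q as [_ Q].
  assert (Hc := pnorm_le_ge_0 _ _ _ Hx).
  assert (Hcr := rpow_ge_0 c (1 / p2)).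
  assert (Q' : pnorm_le p2 (Osub (phi (Oscale (RtoC u) T)) (phi Ozero) x) c).
  { apply pnorm_le_weaken with (2 := Q).
    rewrite rpow_mult, rpow_root by lra. rewrite <- (Rmult_1_l c) at 2.
    apply Rmult_le_compat_r; auto. rewrite <- (rpow_1_l p2). apply rpow_le; lra. }
  replace (Osub (phi (Oscale (RtoC u) T)) (phi Ozero) x)
    with (Sscale (RtoC u) (phi T x)) in Q'.
  2: { apply functional_extensionality; intro n. unfold Osub, Ssub.
       rewrite (Hscal _ _ BT x Hlp n).
       assert (Z : phi Ozero x n = C0).
       { replace Ozero with (Oscale C0 Ozero).
         - rewrite (Hscal C0 _ B0 x Hlp n). unfold Oscale, Sscale; ring.
         - apply functional_extensionality; intro y. apply functional_extensionality; intro i.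
           unfold Oscale, Ozero, Sscale, Szero; ring. }
       rewrite Z. unfold Oscale; ring. }
  replace (phi T x) with (Sscale (RtoC (/ u)) (Sscale (RtoC u) (phi T x))).
  2: { apply functional_extensionality; intro n. unfold Sscale.
       destruct (phi T x n) as [a a']. unfold Cmul, RtoC; simpl. f_equal; field; lra. }
  replace (rpow (/ (d / 2)) p2 * rpow m (1 / p1 * p2)) with (modp p2 (RtoC (/ u))).
  { now apply pnorm_le_scale. }
  assert (0 < / (d / 2)) by (apply Rinv_0_lt_compat; lra).
  unfold modp. rewrite Cmod_RtoC, Rabs_pos_eq by (left; now apply Rinv_0_lt_compat).
  replace (/ u) with (/ (d / 2) * rpow m (1 / p1)) by (unfold u; field; lra).
  rewrite rpow_mult, rpow_rpow by lra. reflexivity.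
Qed.

Lemma hom_signed_sum (p1 p2 : R) (k : cuntz_kind) (Ss Tt : nat -> Op) (phi : Op -> Op)
    (l : list (bool * nat)) (X : nat -> term) (x : Seq) (i : nat) : 0 < p1 ->
  is_rep p1 k Ss Tt -> is_cont_hom p1 p2 (closure_img p1 k Ss Tt) phi ->
  (forall n, term_ok k (X n)) -> in_lp p2 x ->
  phi (eval Ss Tt (signed_sum l X)) x i = scomb l (fun n => phi (eval Ss Tt (X n)) x i).
Proof.
  intros Hp1 Hrep (Heq & _ & Hadd & _ & Hscal & _) HX Hx.
  assert (HB : forall a, term_ok k a -> closure_img p1 k Ss Tt (eval Ss Tt a))
    by (intros; now apply eval_closure_img).
  induction l as [|e l IH].
  - assert (B1 := HB (tconst C0) I). simpl in *.
    (* The empty sum needs [phi] of zero to vanish: zero is written as a zero multiple, and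
       homogeneity pulls the scalar out. *)
    rewrite (Heq _ (Oscale C0 (Oscale C0 Oid)) B1 (HB (tmul (tconst C0) (tconst C0))
      (conj I I))); auto.
    + rewrite (Hscal C0 _ B1 x Hx i). unfold Oscale, Sscale; ring.
    + intros y _ n. unfold Oscale, Oid, Sscale; ring.
  - assert (BX := HB (tmul (tconst (sgn (fst e))) (X (snd e))) (conj I (HX _))).
    assert (BXe := HB (X (snd e)) (HX _)).
    assert (Bl := HB (signed_sum l X) (signed_sum_ok k l X HX)).
    change (scomb (e :: l) ?Y) with (Cadd (Cmul (sgn (fst e)) (Y (snd e))) (scomb l Y)).
    rewrite <- IH.
    change (signed_sum (e :: l) X)
      with (tadd (tmul (tconst (sgn (fst e))) (X (snd e))) (signed_sum l X)).
    change (eval Ss Tt (tadd ?a ?b)) with (Oadd (eval Ss Tt a) (eval Ss Tt b)).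
    rewrite (Hadd _ _ BX Bl x Hx i). unfold Oadd, Sadd. f_equal.
    exact (Hscal (sgn (fst e)) _ BXe x Hx i).
Qed.

Theorem theorem9p2 (p1 p2 : R) (k : cuntz_kind) (Ss Tt : nat -> Op) (phi : Op -> Op) :
  1 <= p1 -> 1 <= p2 -> p1 <> p2 -> kind_ok k ->
  is_spatial_rep p1 k Ss Tt ->
  is_cont_hom p1 p2 (closure_img p1 k Ss Tt) phi ->
  ~ (exists T, closure_img p1 k Ss Tt T /\ ~ op_eq p2 (phi T) Ozero).
Proof.
  intros Hp1 Hp2 Hne Hk [Hrep Hsp] Hphi [T [BT HT]].
  assert (P1 : 0 < p1) by lra. assert (P2 : 0 < p2) by lra.
  destruct (in_range_01 k Hk) as [R0 R1].
  pose proof Hrep as (Hgen & Hid & Hz & _).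
  destruct (spatial_point_map p1 (Ss 0%nat) (Tt 0%nat) P1) as [sg0 H0];
    [now apply Hsp | now apply Hgen | now apply Hid |].
  destruct (spatial_point_map p1 (Ss 1%nat) (Tt 1%nat) P1) as [sg1 H1];
    [now apply Hsp | now apply Hgen | now apply Hid |].
  assert (D : forall x y, sg0 x <> sg1 y).
  { apply (point_map_disjoint p1 (Ss 0%nat) (Tt 0%nat) (Ss 1%nat) (Tt 1%nat)); auto.
    now apply Hgen. }
  assert (HB : forall a, term_ok k a -> closure_img p1 k Ss Tt (eval Ss Tt a))
    by (intros; now apply eval_closure_img).
  pose proof Hphi as (Heq & Hbdd & _ & Hmul & Hscal & _).
  assert (exists x i, in_lp p2 x /\ phi T x i <> C0) as (x & i0 & Hx & Hi0).
  { apply NNPP; intro N. apply HT. intros x Hx i. apply NNPP; intro Q. apply N. now exists x, i. }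
  (* By multiplicativity [phi 1 phi T = phi T], so every vector in the range of [phi T] is fixed by
     [phi 1], even if [phi] is not unital. *)
  set (xi := phi T x).
  assert (Hxi : in_lp p2 xi) by (apply is_bdd_in_lp; auto).
  assert (B1 : closure_img p1 k Ss Tt Oid).
  { replace Oid with (eval Ss Tt (tconst C1)); [now apply HB|].
    apply functional_extensionality; intro y. apply functional_extensionality; intro n.
    simpl. unfold Oscale, Oid, Sscale; ring. }
  assert (Hone : phi Oid xi = xi).
  { apply functional_extensionality; intro i. symmetry. exact (Hmul Oid T B1 BT x Hx i). }
  destruct (in_lp_pnorm_le _ _ Hxi) as [c Hc].
  assert (BZ : closure_img p1 k Ss Tt Ozero).
  { replace Ozero with (eval Ss Tt (tconst C0)); [now apply HB|].
    apply functional_extensionality; intro y. apply functional_extensionality; intro n.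
    simpl. unfold Oscale, Oid, Sscale, Ozero, Szero; ring. }
  destruct (cont_hom_bounded p1 p2 _ phi P1 P2 Hphi BZ) as (K & HK & Hbound).
  (* The exponent of [n^(1/p1)] when measured in [p2]-th powers. *)
  set (r := 1 / p1 * p2).
  assert (Hr : 0 < r).
  { apply Rmult_lt_0_compat; [apply Rdiv_lt_0_compat; lra | lra]. }
  assert (Hr1 : r <> 1).
  { intro E. apply Hne. unfold r in E. apply Rmult_eq_reg_l with (1 / p1).
    - rewrite E. field; lra.
    - apply Rgt_not_eq, Rdiv_lt_0_compat; lra. }
  assert (Hxi0 : 0 < modp p2 (xi i0)).
  { apply rpow_pos. destruct (Rle_lt_or_eq_dec _ _ (Cmod_ge_0 (xi i0))) as [L | E]; auto.
    symmetry in E. now apply Cmod_eq_0 in E. }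
  assert (Hc0 := pnorm_le_ge_0 _ _ _ Hc).
  assert (Hn : forall e l, 1 <= INR (length ((e : bool * nat) :: l))).
  { intros e l. change 1 with (INR 1). apply le_INR. simpl; lia. }
  assert (EV : forall l, (fun i => scomb l (fun n => phi (eval Ss Tt (vterm n)) xi i))
             = phi (eval Ss Tt (signed_sum l vterm)) xi).
  { intro l. apply functional_extensionality; intro i. symmetry.
    apply (hom_signed_sum p1 p2 k); auto. intro n; now apply vterm_ok. }
  assert (BV : forall l, term_ok k (signed_sum l vterm))
    by (intro l; apply signed_sum_ok; intro; now apply vterm_ok).
  assert (BW : forall l, term_ok k (signed_sum l wterm))
    by (intro l; apply signed_sum_ok; intro; now apply wterm_ok).
  assert (BS : forall a c, term_ok k a -> closure_img p1 k Ss Tt (Oscale c (eval Ss Tt a))).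
  { intros a d Ha. exact (HB (tmul (tconst d) a) (conj I Ha)). }
  (* The upper constant uses the bound [c] on the [p2]-th power of the norm of [xi]. The lower one
     looks only at the nonzero coordinate [i0], where the [w]-sum returns [n * xi i0]. *)
  apply (no_power_growth p2 r (K * c) (modp p2 (xi i0) / K)
           (fun n => phi (eval Ss Tt (vterm n)) xi) P2 Hr Hr1).
  - now apply Rdiv_lt_0_compat.
  (* [Hbound] takes a positive bound, so the empty list, whose length is 0, is treated apart. *)
  - intros l Hl. rewrite EV. destruct l as [|e l].
    + rewrite <- EV. intro N. simpl. rewrite (lsum_ext _ (fun _ => 0)).
      * rewrite lsum_const, rpow_0; lra.
      * intros; apply modp_C0.
    + replace (K * c * rpow (INR (length (e :: l))) r)
        with (K * rpow (INR (length (e :: l))) r * c) by ring.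
      apply Hbound; auto; [specialize (Hn e l); lra|].
      eapply vsum_opnormp; eauto.
  - intros l Hl d Hd. rewrite EV in Hd. destruct l as [|e l].
    + simpl. rewrite rpow_0, Rmult_0_r. eapply pnorm_le_ge_0; eauto.
    + set (n := INR (length (e :: l))) in *. specialize (Hn e l). fold n in Hn.
      set (l' := e :: l) in *.
      assert (Q : pnorm_le p2 (phi (eval Ss Tt (signed_sum l' wterm))
                    (phi (eval Ss Tt (signed_sum l' vterm)) xi))
                    (K * rpow (rpow n (p1 - 1)) r * d)).
      { apply Hbound; auto; [apply rpow_pos; lra|]. eapply wsum_opnormp; eauto. }
      apply (pnorm_le_coord _ _ _ i0) in Q.
      assert (Bn : closure_img p1 k Ss Tt (Oscale (RtoC n) Oid))
        by exact (HB (tconst (RtoC n)) I).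
      assert (E : phi (eval Ss Tt (signed_sum l' wterm))
                    (phi (eval Ss Tt (signed_sum l' vterm)) xi) i0
                  = Cmul (RtoC n) (phi Oid xi i0)).
      { transitivity (phi (Omul (eval Ss Tt (signed_sum l' wterm))
                            (eval Ss Tt (signed_sum l' vterm))) xi i0).
        - symmetry. exact (Hmul _ _ (HB _ (BW l')) (HB _ (BV l')) xi Hxi i0).
        - transitivity (phi (Oscale (RtoC n) Oid) xi i0); [|exact (Hscal (RtoC n) Oid B1 xi Hxi i0)].
          exact (Heq _ _ (HB (tmul (signed_sum l' wterm) (signed_sum l' vterm)) (conj (BW l') (BV l'))) Bn
                     (wsum_vsum p1 k Ss Tt l' P1 Hk Hrep Hl) xi Hxi i0). }
      rewrite E, Hone in Q.
      rewrite modp_mul in Q. unfold modp at 1 in Q. rewrite Cmod_RtoC, Rabs_pos_eq in Q by lra.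
      (* Since [p1 * r = p2], the exponents satisfy [(p1 - 1) * r + r = p2]; cancelling the
         [w]-factor leaves exactly [n^r]. *)
      replace (rpow n p2) with (rpow (rpow n (p1 - 1)) r * rpow n r) in Q.
      2: { rewrite rpow_rpow, <- rpow_plus by lra. f_equal. unfold r; field; lra. }
      assert (Hw : 0 < rpow (rpow n (p1 - 1)) r) by (apply rpow_pos, rpow_pos; lra).
      apply Rmult_le_reg_l with (K * rpow (rpow n (p1 - 1)) r);
        [now apply Rmult_lt_0_compat|].
      replace (K * rpow (rpow n (p1 - 1)) r * (modp p2 (xi i0) / K * rpow n r))
        with (rpow (rpow n (p1 - 1)) r * rpow n r * modp p2 (xi i0)) by (field; lra).
      exact Q.
Qed.
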